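(* Let $n\ge 1$ be an integer and let $x_1,\dots,x_n\in\mathbb{C}\setminus\{0,-1,-2,\ldots\}$. Then, with all infinite products over $m$ understood as zeta-regularized products, $$\prod_{m=0}^{\infty}\left(\prod_{j=1}^{n}(m+x_{j})^{(-1)^{m}}\right)=\frac{\left(\sqrt{\pi/2}\right)^n}{\prod_{j=1}^{n}\tilde\Gamma(x_{j})}=\prod_{j=1}^{n}\left(\prod_{m=0}^{\infty}(m+x_{j})^{(-1)^{m}}\right).$$
   Context: Complex powers use the principal branch. Zeta-regularized products: the left-hand side is defined as $\exp(-F'(0))$, where $F(s)=\sum_{m=0}^\infty(-1)^m\prod_{j=1}^n(m+x_j)^{-s}$ for $\mathrm{Re}(s)>0$, analytically continued to a neighbourhood of $s=0$ (the existence of this continuation is part of the assertion). Similarly, $\prod_{m=0}^\infty(m+x_j)^{(-1)^m}:=\exp(-F_j'(0))$, where $F_j$ is the analytic continuation of $F_j(s)=\sum_{m=0}^\infty(-1)^m(m+x_j)^{-s}$. The modified gamma function is $$\tilde\Gamma(x)=\frac1x e^{x\log 2}\prod_{m=1}^\infty\left(e^{-x/m}\left(1+\frac xm\right)\right)^{(-1)^{m+1}},\qquad x\in\mathbb{C}\setminus\{0,-1,-2,\ldots\},$$ with this last infinite product an ordinary convergent product (equivalently, $\tilde\Gamma$ solves $\frac{d}{dx}\log\tilde\Gamma(x)=-\sum_{m=0}^\infty\frac{(-1)^m}{m+x}$ with $\tilde\Gamma(1)=\pi/2$). *)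

(* Defs.v *)
From Stdlib Require Import Reals ClassicalEpsilon.
From mathcomp Require Import ssreflect ssrfun ssrbool eqtype ssrnat seq fintype bigop.
From Coquelicot Require Import Coquelicot.

Open Scope R_scope.
Open Scope C_scope.

Definition Cexp (z : C) : C := RtoC (exp (Re z)) * (cos (Im z), sin (Im z)).

(* For [z <> 0] this is the principal argument, in (-PI, PI]: negative reals
   have argument PI. *)
Definition Carg (z : C) : R :=
  if Rle_dec 0 (Im z) then acos (Re z / Cmod z) else (- acos (Re z / Cmod z))%R.

Definition Clog (z : C) : C := (ln (Cmod z), Carg z).

Definition Cpower (z w : C) : C := Cexp (w * Clog z).

(* [a m s] plays the role of the [-s]-th power of the [m]-th factor. The first
   clause says both that the series converges for Re s > 0 and that [G] is its
   sum there; the second that [G] is holomorphic on the half-plane Re s > 0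
   together with a disc around 0 (a connected open set). *)
Definition is_alt_continuation (a : nat -> C -> C) (G : C -> C) : Prop :=
  (forall s : C, (0 < Re s)%R ->
     @is_series C_AbsRing C_NormedModule
       (fun m : nat => RtoC (-1) ^ m * a m s) (G s)) /\
  (exists r : posreal, forall s : C,
     (0 < Re s)%R \/ (Cmod s < r)%R ->
     @ex_derive C_AbsRing C_NormedModule G s).

Definition has_alt_continuation (a : nat -> C -> C) : Prop :=
  exists G : C -> C, is_alt_continuation a G.

(* exp(-F'(0)). The value does not depend on the continuation [G]: [G] is
   differentiable at 0, so [G 0] and [C_derive G 0] are determined by the values
   of [G] on Re s > 0. Meaningful only under [has_alt_continuation a]. *)
Definition alt_zeta_prod (a : nat -> C -> C) : C :=
  epsilon (inhabits (RtoC 0)) (fun w : C =>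
    exists G : C -> C,
      is_alt_continuation a G /\ w = Cexp (- C_derive G (RtoC 0))).

Definition single_power (y : C) (m : nat) (s : C) : C :=
  Cpower (RtoC (INR m) + y) (- s).

Definition multi_power (n : nat) (x : 'I_n -> C) (m : nat) (s : C) : C :=
  \big[Cmult/RtoC 1]_(j < n) Cpower (RtoC (INR m) + x j) (- s).

Definition mgamma_factor (x : C) (m : nat) : C :=
  let f := Cexp (- (x / RtoC (INR m))) * (RtoC 1 + x / RtoC (INR m)) in
  if odd m then f else / f.

Definition mgamma_partial (x : C) (N : nat) : C :=
  \big[Cmult/RtoC 1]_(1 <= m < N.+1) mgamma_factor x m.

(* Convergence of an infinite product: the limit is required to be nonzero. *)
Definition mgamma_prod_converges (x : C) : Prop :=
  exists l : C, l <> RtoC 0 /\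
    filterlim (mgamma_partial x) eventually (@locally C_UniformSpace l).

(* The limit is taken on real and imaginary parts; meaningful only under
   [mgamma_prod_converges x]. *)
Definition mgamma (x : C) : C :=
  RtoC 1 / x * Cexp (x * RtoC (ln 2)) *
  ((real (Lim_seq (fun N => Re (mgamma_partial x N))),
    real (Lim_seq (fun N => Im (mgamma_partial x N)))) : C).

(* Main.v *)
Require Import Defs.
From Stdlib Require Import Reals Lra Lia ClassicalEpsilon.
From HB Require Import structures.
From mathcomp Require Import ssreflect ssrfun ssrbool eqtype ssrnat seq fintype bigop.
From Coquelicot Require Import Coquelicot.

(** Write [L_m] for the sum over [j] of the principal logarithms of [m + x_j],
so that the [m]-th term of the zeta function is [(-1)^m exp(- s L_m)].

Continuation. Formally the sum over [m] of [(-1)^m u_m] is [1 / (1 + E)]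
applied to [u] at 0, [E] being the shift.  Averaging twice, that is writing
[1 / (1 + E) = 3/4 - E/4 + (1 - E)^2 / (4 (1 + E))], replaces the series by
[(3 u_0 - u_1) / 4] plus a quarter of the alternating sum of the second
differences of [u] ([altsum_diff2]).  For [u_m = exp(- s L_m)] the second
differences are [O(m^(-3/2))], for [Re s > 0] and also for [s] near 0, because
[L] has first and second differences [O(1/m)] and [O(1/m^2)] and grows like a
logarithm ([log_like]).  So the averaged series defines the continuation.
Its complex differentiability needs no Cauchy theory: each term has a first
order expansion with a quadratic remainder whose constant is [O(m^(-3/2))], and
such expansions can be added up ([jet], [jet_series], [jet_diff2]).

Multiplicativity. The series may then be differentiated term by term at
[s = 0], where the derivative of [exp(- s L_m)] is [- L_m]. Hence [- F'(0)] is
the averaged value of the divergent alternating sum of the [L_m]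
([exp_terms_continuation]).  This value is linear in [L], whence the product
formula: no anomaly appears ([regsum_plus], [regsum_sum]).

Value for one point. If [z] is the averaged alternating sum of the
[log (m + x)], then [exp z] is the limit of [(2M+1)^(-1/2)] times the product of
the [(m + x)^((-1)^m)] over [m <= 2M].  The partial products of the modified
gamma function contain the inverse of that product, multiplied by Wallis's
product, which gives [sqrt (pi/2)] after division by [sqrt (2M+1)], and by the
exponential of [- x] times a partial sum of the alternating harmonic series,
which tends to [ln 2] ([mgamma_partial_even], [wallis_limit],
[alternating_harmonic_limit]).  So [mgamma x = sqrt (pi/2) exp (- z)]. *)

Open Scope C_scope.
Open Scope R_scope.

(** * The complex exponential and the principal logarithm *)

Lemma C_eq (z w : C) : Re z = Re w -> Im z = Im w -> z = w.
Proof. by case: z => a b; case: w => c d /= -> ->. Qed.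

Lemma Cexp_pair (z : C) : Cexp z = (exp (Re z) * cos (Im z), exp (Re z) * sin (Im z)).
Proof. by apply: C_eq; rewrite /Cexp /Re /Im /=; ring. Qed.

Lemma Cexp_plus (z w : C) : Cexp (z + w)%C = (Cexp z * Cexp w)%C.
Proof.
rewrite !Cexp_pair; apply: C_eq; rewrite /= exp_plus ?cos_plus ?sin_plus /Re /Im; ring.
Qed.

Lemma Cexp_0 : Cexp 0%C = 1%C.
Proof. by rewrite Cexp_pair; apply: C_eq; rewrite /= exp_0 ?cos_0 ?sin_0; ring. Qed.

Lemma Cexp_real (t : R) : Cexp (RtoC t) = RtoC (exp t).
Proof. by rewrite Cexp_pair; apply: C_eq; rewrite /= ?cos_0 ?sin_0; ring. Qed.

Lemma Cmod_Cexp (z : C) : Cmod (Cexp z) = exp (Re z).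
Proof.
rewrite /Cexp Cmod_mult Cmod_R Rabs_pos_eq; last by left; exact: exp_pos.
rewrite /Cmod /=.
have -> : cos (Im z) * (cos (Im z) * 1) + sin (Im z) * (sin (Im z) * 1) = 1.
  by move: (sin2_cos2 (Im z)); rewrite /Rsqr /Im; lra.
by rewrite sqrt_1; ring.
Qed.

Lemma Cexp_neq_0 (z : C) : Cexp z <> 0%C.
Proof. apply/Cmod_gt_0; rewrite Cmod_Cexp; exact: exp_pos. Qed.

Lemma Cexp_opp (z : C) : Cexp (- z)%C = (/ Cexp z)%C.
Proof.
have h : (Cexp z * Cexp (- z) = 1)%C by rewrite -Cexp_plus Cplus_opp_r Cexp_0.
have hz := Cexp_neq_0 z.
rewrite -[LHS]Cmult_1_l -(Cinv_l (Cexp z)) //.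
by rewrite -Cmult_assoc h Cmult_1_r.
Qed.

Lemma Cexp_Clog (z : C) : z <> 0%C -> Cexp (Clog z) = z.
Proof.
move=> hz; have hm : 0 < Cmod z by apply/Cmod_gt_0.
rewrite Cexp_pair /= exp_ln // /Carg.
have hn : Cmod z * Cmod z = Re z * Re z + Im z * Im z.
  by move: (Cmod2_alt z) => /= H; nra.
have hre := re_le_Cmod z.
have hb : -1 <= Re z / Cmod z <= 1.
  move: (Rabs_def2 (Re z) (Cmod z)) (Rle_abs (Re z)) (Rle_abs (- Re z)); rewrite Rabs_Ropp => _ h1 h2.
  split; [apply: (Rmult_le_reg_r (Cmod z)) => //|apply: (Rmult_le_reg_r (Cmod z)) => //];
  by rewrite /Rdiv Rmult_assoc Rinv_l; lra.
have hs : Cmod z * sqrt (1 - (Re z / Cmod z)²) = Rabs (Im z).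
  rewrite -sqrt_Rsqr_abs -{1}(sqrt_Rsqr (Cmod z)); last lra.
  rewrite -sqrt_mult; last 2 first.
  - exact: Rle_0_sqr.
  - have -> : 1 - (Re z / Cmod z)² = (Im z / Cmod z)².
      rewrite /Rsqr; field_simplify_eq; [nra | lra].
    exact: Rle_0_sqr.
  congr sqrt; rewrite /Rsqr; field_simplify_eq; [nra | lra].
have hc : Cmod z * (Re z / Cmod z) = Re z by field; lra.
apply: C_eq => /=.
- case: Rle_dec => h; first by rewrite cos_acos.
  by rewrite cos_neg cos_acos.
- case: Rle_dec => h; first by rewrite sin_acos // hs Rabs_pos_eq.
  rewrite sin_neg sin_acos // -Ropp_mult_distr_r hs Rabs_left; lra.
Qed.

Lemma Rabs_Im_Clog (z : C) : Rabs (Im (Clog z)) <= PI.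
Proof.
rewrite /= /Carg; have [h1 h2] := acos_bound (Re z / Cmod z).
by case: Rle_dec => h; rewrite ?Rabs_Ropp Rabs_pos_eq.
Qed.

(** On the right half-plane both parts of the principal logarithm become smooth
functions of the coordinates, to which real calculus applies. *)
Lemma Clog_right (a b : R) : 0 < a ->
  Clog (a, b) = (/ 2 * ln (a ^ 2 + b ^ 2), atan (b / a)).
Proof.
move=> ha.
have hp : 0 < a ^ 2 + b ^ 2 by nra.
have hm : 0 < Cmod (a, b) by apply: sqrt_lt_R0.
have hm2 : Cmod (a, b) * Cmod (a, b) = a ^ 2 + b ^ 2 by exact: (sqrt_sqrt _ (Rlt_le _ _ hp)).
rewrite /Clog; f_equal.
- rewrite -hm2 ln_mult //; field.
- rewrite /Carg /= acos_atan; last by apply: Rdiv_lt_0_compat.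
  have -> : sqrt (1 - (a / Cmod (a, b))²) = Rabs b / Cmod (a, b).
    rewrite -(sqrt_Rsqr (Rabs b / Cmod (a, b))); last first.
      apply: Rmult_le_pos; [exact: Rabs_pos | left; exact: Rinv_0_lt_compat].
    congr sqrt; rewrite /Rsqr.
    have -> : Rabs b / Cmod (a, b) * (Rabs b / Cmod (a, b)) = (Rabs b * Rabs b) / (Cmod (a, b) * Cmod (a, b)).
      field; lra.
    have -> : a / Cmod (a, b) * (a / Cmod (a, b)) = a * a / (Cmod (a, b) * Cmod (a, b)).
      field; lra.
    rewrite hm2 -Rabs_mult Rabs_pos_eq; last nra.
    field; lra.
  have -> : Rabs b / Cmod (a, b) / (a / Cmod (a, b)) = Rabs b / a by field; lra.
  case: Rle_dec => hb; first by rewrite Rabs_pos_eq.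
  rewrite -atan_opp Rabs_left; last lra.
  congr atan; field; lra.
Qed.

Lemma Rabs_exp_m1 (a : R) : Rabs (exp a - 1) <= Rabs a * exp (Rabs a).
Proof.
have h1 := exp_ineq1_le a; have h2 := exp_ineq1_le (- a).
have h3 := exp_pos a; have h4 : exp a * exp (- a) = 1.
  by rewrite -exp_plus Rplus_opp_r exp_0.
case: (Rle_dec 0 a) => ha.
- rewrite !Rabs_pos_eq; [nra | lra | lra].
- rewrite (Rabs_left a) ?(Rabs_left1 (exp a - 1)); try lra; nra.
Qed.

Lemma Rabs_exp_m1_mid (a : R) : Rabs (exp a - 1 - a) <= a ^ 2 * exp (Rabs a).
Proof.
have h1 := exp_ineq1_le a; have h2 := exp_ineq1_le (- a).
have h3 := exp_pos a; have h4 : exp a * exp (- a) = 1.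
  by rewrite -exp_plus Rplus_opp_r exp_0.
rewrite Rabs_pos_eq; last lra.
case: (Rle_dec 0 a) => ha.
- rewrite Rabs_pos_eq //.
  have h5 : exp a - 1 <= a * exp a by nra.
  nra.
- rewrite (Rabs_left a); last lra.
  have h5 : 1 - exp a <= - a by lra.
  have h6 : exp a * (1 - a) <= 1 by nra.
  have h7 : exp a - 1 - a <= a ^ 2 by nra.
  nra.
Qed.

Lemma Rabs_sin_le (b : R) : Rabs (sin b) <= Rabs b.
Proof.
have [c [hc _]] := MVT_abs sin cos 0 b (fun c _ => derivable_pt_lim_sin c).
rewrite sin_0 !Rminus_0_r in hc; rewrite hc.
have h1 := Rabs_pos b; have [h2 h3] := COS_bound c.
have h4 : Rabs (cos c) <= 1 by apply: Rabs_le; lra.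
nra.
Qed.

Lemma Rabs_cos_m1 (b : R) : Rabs (cos b - 1) <= Rabs b /\ Rabs (cos b - 1) <= b ^ 2.
Proof.
have [c [hc hcb]] := MVT_abs cos (fun t => - sin t) 0 b
  (fun c _ => derivable_pt_lim_cos c).
rewrite cos_0 Rminus_0_r Rabs_Ropp in hc; rewrite hc.
have h1 := Rabs_pos b; have [h2 h3] := SIN_bound c.
have h4 : Rabs (sin c) <= 1 by apply: Rabs_le; lra.
have h5 := Rabs_sin_le c; have h6 := Rabs_pos (sin c).
have h7 : Rabs c <= Rabs b.
  move: hcb; rewrite /Rmin /Rmax; case: Rle_dec => h [h8 h9].
  - by rewrite !Rabs_pos_eq; lra.
  - by rewrite !Rabs_left1; lra.
have h8 : b ^ 2 = Rabs b * Rabs b by rewrite -Rabs_mult Rabs_pos_eq; nra.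
by split; nra.
Qed.

Lemma Rabs_sin_mid (b : R) : Rabs (sin b - b) <= b ^ 2.
Proof.
have [c [hc hcb]] := MVT_abs (fun t => sin t - t) (fun t => cos t - 1) 0 b
  (fun c _ => derivable_pt_lim_minus _ _ _ _ _ (derivable_pt_lim_sin c) (derivable_pt_lim_id c)).
rewrite sin_0 !Rminus_0_r in hc; rewrite hc.
have h1 := Rabs_pos b; have [h2 _] := Rabs_cos_m1 c.
have h7 : Rabs c <= Rabs b.
  move: hcb; rewrite /Rmin /Rmax; case: Rle_dec => h [h8 h9].
  - by rewrite !Rabs_pos_eq; lra.
  - by rewrite !Rabs_left1; lra.
have h8 : b ^ 2 = Rabs b * Rabs b by rewrite -Rabs_mult Rabs_pos_eq; nra.
nra.
Qed.

Lemma Cmod_le_sum (z : C) : Cmod z <= Rabs (Re z) + Rabs (Im z).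
Proof.
have h := Cmod2_alt z; have h0 := Cmod_ge_0 z.
have h1 := Rabs_pos (Re z); have h2 := Rabs_pos (Im z).
have h3 := pow2_abs (Re z); have h4 := pow2_abs (Im z).
nra.
Qed.

Lemma im_le_Cmod (z : C) : Rabs (Im z) <= Cmod z.
Proof. by move: (Rmax_Cmod z) (Rmax_r (Rabs (fst z)) (Rabs (snd z))); rewrite /Im; lra. Qed.

Lemma exp_le_exp (a b : R) : a <= b -> exp a <= exp b.
Proof. by case=> [h|->]; [left; exact: exp_increasing | right]. Qed.

Lemma exp_le_Cmod (z : C) :
  1 <= exp (Rabs (Re z)) <= exp (Cmod z) /\ exp (Re z) <= exp (Rabs (Re z)).
Proof.
have h := re_le_Cmod z; have h0 := Rabs_pos (Re z); have h1 := Rle_abs (Re z).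
repeat split; try exact: exp_le_exp.
have := exp_ineq1_le (Rabs (Re z)); lra.
Qed.

(** The constants 3 here and in [Cmod_exp_m1_mid] are not optimal: they come from
bounding the real and the imaginary parts separately. *)
Lemma Cmod_exp_m1 (z : C) : Cmod (Cexp z - 1)%C <= 3 * Cmod z * exp (Cmod z).
Proof.
apply: Rle_trans (Cmod_le_sum _) _.
rewrite Cexp_pair /Re /Im /= -/(Re z) -/(Im z).
have [[hA hB] hC] := exp_le_Cmod z.
have h1 := re_le_Cmod z; have h2 := im_le_Cmod z.
have h3 := Rabs_exp_m1 (Re z).
have [h4 _] := Rabs_cos_m1 (Im z); have h5 := Rabs_sin_le (Im z).
have p1 := Rabs_pos (Re z); have p2 := Rabs_pos (Im z); have p3 := exp_pos (Re z).
have e1 : Rabs (exp (Re z) * cos (Im z) + - (1)) <=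
  exp (Re z) * Rabs (cos (Im z) - 1) + Rabs (exp (Re z) - 1).
  have -> : exp (Re z) * cos (Im z) + - (1) = exp (Re z) * (cos (Im z) - 1) + (exp (Re z) - 1) by ring.
  apply: Rle_trans (Rabs_triang _ _) _; rewrite Rabs_mult (Rabs_pos_eq (exp _)); lra.
have e2 : Rabs (exp (Re z) * sin (Im z) + - 0) = exp (Re z) * Rabs (sin (Im z)).
  by rewrite Ropp_0 Rplus_0_r Rabs_mult (Rabs_pos_eq (exp _)) //; lra.
rewrite e2.
set E := exp (Rabs (Re z)) in hA hB hC h3 *.
set a := Rabs (Re z) in p1 h1 h3 *; set b := Rabs (Im z) in p2 h2 h4 h5 *.
have g1 : exp (Re z) * Rabs (cos (Im z) - 1) <= E * b.
  by apply: Rmult_le_compat; try lra; exact: Rabs_pos.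
have g2 : exp (Re z) * Rabs (sin (Im z)) <= E * b.
  by apply: Rmult_le_compat; try lra; exact: Rabs_pos.
have g3 : E * (2 * b + a) <= E * (3 * Cmod z) by apply: Rmult_le_compat_l; lra.
have g4 : E * (3 * Cmod z) <= exp (Cmod z) * (3 * Cmod z) by apply: Rmult_le_compat_r; lra.
lra.
Qed.

Lemma Cmod_exp_m1_mid (z : C) :
  Cmod (Cexp z - 1 - z)%C <= 3 * Cmod z ^ 2 * exp (Cmod z).
Proof.
apply: Rle_trans (Cmod_le_sum _) _.
rewrite Cexp_pair /Re /Im /= -/(Re z) -/(Im z) !Rmult_1_r.
have [[hA hB] hC] := exp_le_Cmod z.
have h1 := re_le_Cmod z; have h2 := im_le_Cmod z; have h0 := Cmod2_alt z.
have h3 := Rabs_exp_m1 (Re z); have h3' := Rabs_exp_m1_mid (Re z).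
have [_ h4] := Rabs_cos_m1 (Im z); have h5 := Rabs_sin_mid (Im z).
have p1 := Rabs_pos (Re z); have p2 := Rabs_pos (Im z); have p3 := exp_pos (Re z).
have q1 := pow2_abs (Re z); have q2 := pow2_abs (Im z).
have e1 : Rabs (exp (Re z) * cos (Im z) + - (1) + - Re z) <=
  exp (Re z) * Rabs (cos (Im z) - 1) + Rabs (exp (Re z) - 1 - Re z).
  have -> : exp (Re z) * cos (Im z) + - (1) + - Re z =
    exp (Re z) * (cos (Im z) - 1) + (exp (Re z) - 1 - Re z) by ring.
  apply: Rle_trans (Rabs_triang _ _) _; rewrite Rabs_mult (Rabs_pos_eq (exp _)); lra.
have e2 : Rabs (exp (Re z) * sin (Im z) + - 0 + - Im z) <=
  exp (Re z) * Rabs (sin (Im z) - Im z) + Rabs (Im z) * Rabs (exp (Re z) - 1).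
  have -> : exp (Re z) * sin (Im z) + - 0 + - Im z =
    exp (Re z) * (sin (Im z) - Im z) + Im z * (exp (Re z) - 1) by ring.
  apply: Rle_trans (Rabs_triang _ _) _; rewrite !Rabs_mult (Rabs_pos_eq (exp _)); lra.
set E := exp (Rabs (Re z)) in hA hB hC h3 h3' *.
set a := Rabs (Re z) in p1 h1 h3 q1 e2 *; set b := Rabs (Im z) in p2 h2 q2 e2 *.
have g1 : exp (Re z) * Rabs (cos (Im z) - 1) <= E * Im z ^ 2.
  by apply: Rmult_le_compat; try lra; exact: Rabs_pos.
have g2 : exp (Re z) * Rabs (sin (Im z) - Im z) <= E * Im z ^ 2.
  by apply: Rmult_le_compat; try lra; exact: Rabs_pos.
have g3 : b * Rabs (exp (Re z) - 1) <= b * (a * E) by apply: Rmult_le_compat_l; lra.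
have g5 : 2 * b ^ 2 + a ^ 2 + b * a <= 3 * Cmod z ^ 2 by rewrite h0; nra.
have g6 : E * (2 * b ^ 2 + a ^ 2 + b * a) <= E * (3 * Cmod z ^ 2).
  by apply: Rmult_le_compat_l; lra.
have g4 : E * (3 * Cmod z ^ 2) <= exp (Cmod z) * (3 * Cmod z ^ 2).
  by apply: Rmult_le_compat_r; nra.
have -> : 3 * (Cmod z * Cmod z) = 3 * Cmod z ^ 2 by ring.
nra.
Qed.

(** * Limits of complex sequences *)

(** Stated with the modulus, so that algebra of limits reduces to real sequences. *)
Definition cvgC (u : nat -> C) (l : C) : Prop :=
  is_lim_seq (fun n => Cmod (u n - l)%C) 0.

Lemma cvgC_filterlim (u : nat -> C) (l : C) :
  cvgC u l <-> filterlim u eventually (@locally C_UniformSpace l).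
Proof.
split=> [/is_lim_seq_spec h|h].
- apply/filterlim_locally => eps.
  have [N hN] := h eps; exists N => n hn.
  apply: C_NormedModule_mixin_compat1.
  have := hN n hn; rewrite Rminus_0_r Rabs_pos_eq //; exact: Cmod_ge_0.
- apply/is_lim_seq_spec => eps.
  have h2 : 0 < sqrt 2 by apply: sqrt_lt_R0; lra.
  have he : 0 < eps / sqrt 2 by apply: Rdiv_lt_0_compat => //; exact: cond_pos.
  have [N hN] := proj1 (filterlim_locally u l) h (mkposreal _ he).
  exists N => n hn; rewrite Rminus_0_r Rabs_pos_eq; last exact: Cmod_ge_0.
  have := C_NormedModule_mixin_compat2 _ _ _ (hN n hn) => /=.
  have -> : sqrt 2 * (eps / sqrt 2) = eps by field; lra.
  by [].
Qed.

Lemma is_series_C (u : nat -> C) (l : C) :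
  @is_series C_AbsRing C_NormedModule u l <-> cvgC (sum_n u) l.
Proof. by split=> [/cvgC_filterlim|/cvgC_filterlim]. Qed.

Lemma cvgC_ext (u v : nat -> C) (l : C) : (forall n, u n = v n) -> cvgC u l -> cvgC v l.
Proof. by move=> h; apply: is_lim_seq_ext => n; rewrite h. Qed.

Lemma cvgC_le (u : nat -> C) (l : C) (b : nat -> R) :
  (forall n, Cmod (u n - l)%C <= b n) -> is_lim_seq b 0 -> cvgC u l.
Proof.
move=> h hb; apply: is_lim_seq_le_le (is_lim_seq_const 0) hb => n.
by split; [exact: Cmod_ge_0 | exact: h].
Qed.

Lemma cvgC_const (c : C) : cvgC (fun _ => c) c.
Proof.
apply: (cvgC_le _ _ (fun _ => 0)); last exact: is_lim_seq_const.
by move=> _; rewrite /Cminus Cplus_opp_r Cmod_0; lra.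
Qed.

Lemma cvgC_plus (u v : nat -> C) (l m : C) :
  cvgC u l -> cvgC v m -> cvgC (fun n => (u n + v n)%C) (l + m)%C.
Proof.
move=> hu hv; apply: (cvgC_le _ _ (fun n => Cmod (u n - l)%C + Cmod (v n - m)%C)).
- move=> n; have -> : (u n + v n - (l + m) = (u n - l) + (v n - m))%C by ring.
  exact: Cmod_triangle.
- have := is_lim_seq_plus' _ _ _ _ hu hv; by rewrite Rplus_0_r.
Qed.

Lemma cvgC_mult (u v : nat -> C) (l m : C) :
  cvgC u l -> cvgC v m -> cvgC (fun n => (u n * v n)%C) (l * m)%C.
Proof.
move=> hu hv.
apply: (cvgC_le _ _ (fun n => Cmod (u n - l)%C * Cmod (v n - m)%C +
   (Cmod (u n - l)%C * Cmod m + Cmod l * Cmod (v n - m)%C))).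
- move=> n; have -> : (u n * v n - l * m = (u n - l) * (v n - m) + ((u n - l) * m + l * (v n - m)))%C by ring.
  rewrite -!Cmod_mult.
  apply: Rle_trans (Cmod_triangle _ _) _; apply: Rplus_le_compat_l.
  exact: Cmod_triangle.
- have -> : 0 = 0 * 0 + (0 * Cmod m + Cmod l * 0) by ring.
  apply: is_lim_seq_plus'; first exact: is_lim_seq_mult'.
  apply: is_lim_seq_plus'; apply: is_lim_seq_mult' => //; exact: is_lim_seq_const.
Qed.

Lemma cvgC_unique (u : nat -> C) (l m : C) : cvgC u l -> cvgC u m -> l = m.
Proof.
move=> hl hm.
have h : cvgC (fun n => 0%C) (l - m)%C.
  have := cvgC_plus _ _ _ _ hl (cvgC_mult _ _ _ _ (cvgC_const (- (RtoC 1))%C) hm).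
  have -> : (l + - (RtoC 1) * m = l - m)%C by ring.
  by apply: cvgC_ext => n; ring.
have h0 : Finite (Cmod (0 - (l - m))%C) = Finite 0.
  rewrite -(is_lim_seq_unique _ _ h); symmetry; apply: is_lim_seq_unique.
  exact: is_lim_seq_const.
have h1 : (0 - (l - m))%C = 0%C by apply: Cmod_eq_0; case: h0.
have -> : l = (m - (0 - (l - m)))%C by ring.
rewrite h1; ring.
Qed.

Lemma cvgC_sub (u : nat -> C) (l : C) (phi : nat -> nat) :
  filterlim phi eventually eventually -> cvgC u l -> cvgC (fun n => u (phi n)) l.
Proof. by move=> hp h; apply: (is_lim_seq_subseq (fun n => Cmod (u n - l)%C)). Qed.

Lemma cvgC_Cexp (u : nat -> C) (l : C) :
  cvgC u l -> cvgC (fun n => Cexp (u n)) (Cexp l).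
Proof.
move=> h.
apply: (cvgC_le _ _ (fun n => exp (Re l) * (3 * Cmod (u n - l)%C * exp (Cmod (u n - l)%C)))).
- move=> n.
  have -> : (Cexp (u n) - Cexp l = Cexp l * (Cexp (u n - l) - 1))%C.
    have -> : Cexp (u n) = Cexp (l + (u n - l))%C by congr Cexp; ring.
    rewrite Cexp_plus; ring.
  rewrite Cmod_mult Cmod_Cexp; apply: Rmult_le_compat_l; first by left; exact: exp_pos.
  exact: Cmod_exp_m1.
- have -> : 0 = exp (Re l) * (3 * 0 * exp 0) by ring.
  apply: is_lim_seq_mult'; first exact: is_lim_seq_const.
  apply: is_lim_seq_mult'; first by apply: is_lim_seq_mult' => //; exact: is_lim_seq_const.
  apply: (is_lim_seq_continuous exp _ 0) => //.
  apply: derivable_continuous_pt; exact: derivable_pt_exp.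
Qed.

Lemma is_lim_seq_val (u : nat -> R) (l l' : R) : l = l' -> is_lim_seq u l -> is_lim_seq u l'.
Proof. by move=> ->. Qed.

Lemma cvgC_RtoC (u : nat -> R) (l : R) : is_lim_seq u l -> cvgC (fun n => RtoC (u n)) (RtoC l).
Proof.
move=> h; apply: (cvgC_le _ _ (fun n => Rabs (u n - l))).
  by move=> n; rewrite -RtoC_minus Cmod_R; lra.
have h1 : is_lim_seq (fun n => u n - l) 0.
  apply: (is_lim_seq_val _ (l - l)); first ring.
  by apply: is_lim_seq_minus' => //; exact: is_lim_seq_const.
by have := is_lim_seq_abs _ _ h1; rewrite /= Rabs_R0.
Qed.

Lemma cvgC_Re_Im (u : nat -> C) (l : C) :
  cvgC u l -> is_lim_seq (fun n => Re (u n)) (Re l) /\ is_lim_seq (fun n => Im (u n)) (Im l).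
Proof.
have aux (v : nat -> R) (w : R) : is_lim_seq (fun n => Rabs (v n - w)) 0 -> is_lim_seq v w.
  move=> h; have h0 := proj2 (is_lim_seq_abs_0 _) h.
  apply: (is_lim_seq_ext (fun n => (v n - w) + w)) => [n|]; first ring.
  apply: (is_lim_seq_val _ (0 + w)); first ring.
  by apply: is_lim_seq_plus' => //; exact: is_lim_seq_const.
move=> h; split; apply: aux; apply: is_lim_seq_le_le (is_lim_seq_const 0) h => n; split; try exact: Rabs_pos.
- have -> : Re (u n) - Re l = Re (u n - l)%C by rewrite /Re /=; ring.
  exact: re_le_Cmod.
- have -> : Im (u n) - Im l = Im (u n - l)%C by rewrite /Im /=; ring.
  exact: im_le_Cmod.
Qed.

Lemma cvgC_even_odd (u : nat -> C) (l : C) :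
  cvgC (fun M => u (2 * M)%coq_nat) l -> cvgC (fun M => u (S (2 * M)%coq_nat)) l -> cvgC u l.
Proof.
move=> /is_lim_seq_spec h0 /is_lim_seq_spec h1; apply/is_lim_seq_spec => eps.
have [N0 H0] := h0 eps; have [N1 H1] := h1 eps.
exists (S (Nat.mul 2 (Nat.add N0 N1))) => n hn.
case: (Nat.Even_or_Odd n) => [[M e]|[M e]].
- rewrite e; apply: H0; lia.
- rewrite e Nat.add_1_r; apply: H1; lia.
Qed.

Lemma cvgC_opp (u : nat -> C) (l : C) : cvgC u l -> cvgC (fun n => - u n)%C (- l)%C.
Proof.
move=> h; have := cvgC_mult _ _ _ _ (cvgC_const (- RtoC 1)%C) h.
have -> : (- RtoC 1 * l = - l)%C by ring.
by apply: cvgC_ext => n; ring.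
Qed.

Lemma ball_C_abs (x y : C) (e : R) :
  @ball (AbsRing_UniformSpace C_AbsRing) x e y = (Cmod (y - x)%C < e).
Proof. by []. Qed.

(** * Differentiability through quadratic remainders *)

(** A first order expansion of [f] at [s], with derivative [l] and a remainder at
most [K |t|^2] on the disc of radius [rho]. The same [K] also bounds the value
and the derivative, which makes these expansions stable under products
([jet_mult]) and lets one summable sequence of constants control a whole series
([jet_series]). *)
Definition jet (rho K : R) (f : C -> C) (s l : C) : Prop :=
  Cmod (f s) <= K /\ Cmod l <= K /\
  forall t : C, Cmod t <= rho -> Cmod (f (s + t) - f s - t * l)%C <= K * Cmod t ^ 2.

Lemma jet_is_derive (rho K : R) (f : C -> C) (s l : C) :
  0 < rho -> jet rho K f s l -> @is_derive C_AbsRing C_NormedModule f s l.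
Proof.
move=> hr [_ [hl hj]]; split; first exact: is_linear_scal_l.
move=> y hy; have {hy} <- := is_filter_lim_locally_unique _ _ hy; move=> eps.
have hK : 0 <= K by apply: Rle_trans (Cmod_ge_0 _) hl.
have he : 0 < Rmin rho (eps / (K + 1)).
  apply: Rmin_glb_lt => //; apply: Rdiv_lt_0_compat; [exact: cond_pos | lra].
exists (mkposreal _ he) => t ht.
have {}ht : Cmod (t - s)%C < Rmin rho (eps / (K + 1)) by exact: ht.
change (Cmod (f t - f s - (t - s) * l)%C <= eps * Cmod (t - s)%C).
have h1 := Rmin_l rho (eps / (K + 1)); have h2 := Rmin_r rho (eps / (K + 1)).
have := hj (t - s)%C; have -> : (s + (t - s) = t)%C by ring.
move=> /(_ (Rlt_le _ _ (Rlt_le_trans _ _ _ ht h1))) h.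
apply: Rle_trans h _.
have h0 := Cmod_ge_0 (t - s)%C.
have h3 : (K + 1) * Cmod (t - s)%C <= eps.
  have -> : pos eps = (K + 1) * (eps / (K + 1)) by field; lra.
  apply: Rmult_le_compat_l; lra.
nra.
Qed.

Lemma jet_le (rho K K' : R) (f : C -> C) (s l : C) :
  K <= K' -> jet rho K f s l -> jet rho K' f s l.
Proof.
move=> hK [h1 [h2 h3]]; split; first lra; split; first lra.
move=> t ht; apply: Rle_trans (h3 t ht) _; apply: Rmult_le_compat_r => //.
exact: pow2_ge_0.
Qed.

Lemma jet_ext (rho K : R) (f g : C -> C) (s l : C) :
  (forall t, f t = g t) -> jet rho K f s l -> jet rho K g s l.
Proof. by move=> h [h1 [h2 h3]]; split; rewrite -?h //; split=> // t ht; rewrite -!h; exact: h3. Qed.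

Lemma jet_plus (rho K1 K2 : R) (f g : C -> C) (s l m : C) :
  jet rho K1 f s l -> jet rho K2 g s m ->
  jet rho (K1 + K2) (fun t => f t + g t)%C s (l + m)%C.
Proof.
move=> [f1 [f2 f3]] [g1 [g2 g3]]; split; [|split].
- apply: Rle_trans (Cmod_triangle _ _) _; lra.
- apply: Rle_trans (Cmod_triangle _ _) _; lra.
- move=> t ht.
  have -> : (f (s + t) + g (s + t) - (f s + g s) - t * (l + m) =
    (f (s + t) - f s - t * l) + (g (s + t) - g s - t * m))%C by ring.
  apply: Rle_trans (Cmod_triangle _ _) _.
  have := f3 t ht; have := g3 t ht; lra.
Qed.

(** The expansion at the centre also bounds [f] on the whole disc, so that the
convergence of a series at the centre propagates to the disc. *)
Lemma jet_bound (rho K : R) (f : C -> C) (s l t : C) :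
  rho <= 1 -> jet rho K f s l -> Cmod t <= rho -> Cmod (f (s + t))%C <= 3 * K.
Proof.
move=> hr [h1 [h2 h3]] ht.
have h0 := Cmod_ge_0 t; have hK := Cmod_ge_0 (f s); have hl := Cmod_ge_0 l.
have -> : (f (s + t) = (f (s + t) - f s - t * l) + (f s + t * l))%C by ring.
apply: Rle_trans (Cmod_triangle _ _) _.
have h4 := Cmod_triangle (f s) (t * l)%C; rewrite Cmod_mult in h4.
have h5 := h3 t ht.
have h6 : Cmod t * Cmod l <= K by nra.
have h7 : Cmod t ^ 2 <= 1 by nra.
have h8 : K * Cmod t ^ 2 <= K by nra.
lra.
Qed.

Lemma jet_mult (rho K1 K2 : R) (f g : C -> C) (s l m : C) :
  rho <= 1 -> jet rho K1 f s l -> jet rho K2 g s m ->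
  jet rho (6 * K1 * K2) (fun t => f t * g t)%C s (l * g s + f s * m)%C.
Proof.
move=> hr jf jg; have [f1 [f2 f3]] := jf; have [g1 [g2 g3]] := jg.
have pf := Cmod_ge_0 (f s); have pg := Cmod_ge_0 (g s).
have pl := Cmod_ge_0 l; have pm := Cmod_ge_0 m.
have hK : 0 <= K1 * K2 by apply: Rmult_le_pos; lra.
have hfg : Cmod (f s) * Cmod (g s) <= K1 * K2 by apply: Rmult_le_compat; lra.
have hlg : Cmod l * Cmod (g s) <= K1 * K2 by apply: Rmult_le_compat; lra.
have hfm : Cmod (f s) * Cmod m <= K1 * K2 by apply: Rmult_le_compat; lra.
have hlm : Cmod l * Cmod m <= K1 * K2 by apply: Rmult_le_compat; lra.
split; [|split].
- rewrite Cmod_mult; lra.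
- apply: Rle_trans (Cmod_triangle _ _) _; rewrite !Cmod_mult; lra.
- move=> t ht; have ptt := Cmod_ge_0 t.
  have -> : (f (s + t) * g (s + t) - f s * g s - t * (l * g s + f s * m) =
    f (s + t) * (g (s + t) - g s - t * m) +
    ((f (s + t) - f s - t * l) * (g s + t * m) + t * t * (l * m)))%C by ring.
  have hF := jet_bound _ _ _ _ _ _ hr jf ht.
  apply: Rle_trans (Cmod_triangle _ _) _.
  have h2 := Cmod_triangle ((f (s + t) - f s - t * l) * (g s + t * m))%C (t * t * (l * m))%C.
  have h3 := Cmod_triangle (g s) (t * m)%C.
  rewrite !Cmod_mult in h2 h3 *.
  have h4 := f3 t ht; have h5 := g3 t ht.
  have b1 : Cmod (f (s + t)%C) * Cmod (g (s + t) - g s - t * m)%C <= 3 * K1 * (K2 * Cmod t ^ 2).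
    by apply: Rmult_le_compat => //; exact: Cmod_ge_0.
  have b2 : Cmod (g s + t * m)%C <= 2 * K2 by nra.
  have b3 : Cmod (f (s + t) - f s - t * l)%C * Cmod (g s + t * m)%C <= (K1 * Cmod t ^ 2) * (2 * K2).
    by apply: Rmult_le_compat => //; exact: Cmod_ge_0.
  have b4 : Cmod t * Cmod t * (Cmod l * Cmod m) <= Cmod t * Cmod t * (K1 * K2).
    by apply: Rmult_le_compat_l => //; nra.
  nra.
Qed.

Lemma jet_scal (rho K : R) (c : C) (f : C -> C) (s l : C) :
  jet rho K f s l -> jet rho (Cmod c * K) (fun t => c * f t)%C s (c * l)%C.
Proof.
have hc := Cmod_ge_0 c.
move=> [h1 [h2 h3]]; split; [|split] => [||t ht]; rewrite ?Cmod_mult.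
- exact: Rmult_le_compat_l.
- exact: Rmult_le_compat_l.
- have -> : (c * f (s + t) - c * f s - t * (c * l) = c * (f (s + t) - f s - t * l))%C by ring.
  rewrite Cmod_mult Rmult_assoc; apply: Rmult_le_compat_l => //; exact: h3.
Qed.

Lemma jet_linear (rho : R) (c s : C) : jet rho ((1 + Cmod s) * Cmod c) (fun t => t * c)%C s c.
Proof.
have hc := Cmod_ge_0 c; have hs := Cmod_ge_0 s.
split; [|split] => [||t ht]; rewrite ?Cmod_mult; try nra.
have -> : ((s + t) * c - s * c - t * c = 0)%C by ring.
rewrite Cmod_0; apply: Rmult_le_pos; [nra | exact: pow2_ge_0].
Qed.

Lemma jet_exp (rho : R) (lam s : C) :
  0 <= rho ->
  jet rho (3 * Cmod (Cexp (s * lam)%C) * (1 + Cmod lam) ^ 2 * exp (rho * Cmod lam))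
    (fun t => Cexp (t * lam)%C) s (lam * Cexp (s * lam))%C.
Proof.
move=> hr; have hl := Cmod_ge_0 lam; have he := Cmod_ge_0 (Cexp (s * lam)%C).
have hE : 1 <= exp (rho * Cmod lam).
  have := exp_ineq1_le (rho * Cmod lam); nra.
have h2 : 1 <= (1 + Cmod lam) ^ 2 by nra.
have h3 : Cmod lam <= (1 + Cmod lam) ^ 2 by nra.
have h4 : Cmod lam ^ 2 <= (1 + Cmod lam) ^ 2 by nra.
split; [|split] => [||t ht].
- have : Cmod (Cexp (s * lam)%C) * 1 * 1 <= Cmod (Cexp (s * lam)%C) * (1 + Cmod lam) ^ 2 * exp (rho * Cmod lam).
    by apply: Rmult_le_compat; nra.
  nra.
- rewrite Cmod_mult.
  have : Cmod (Cexp (s * lam)%C) * Cmod lam * 1 <= Cmod (Cexp (s * lam)%C) * (1 + Cmod lam) ^ 2 * exp (rho * Cmod lam).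
    by apply: Rmult_le_compat; nra.
  nra.
- have -> : (Cexp ((s + t) * lam) - Cexp (s * lam) - t * (lam * Cexp (s * lam)) =
    Cexp (s * lam) * (Cexp (t * lam) - 1 - t * lam))%C.
    have -> : ((s + t) * lam = s * lam + t * lam)%C by ring.
    rewrite Cexp_plus; ring.
  rewrite Cmod_mult; have ht0 := Cmod_ge_0 t.
  have h5 := Cmod_exp_m1_mid (t * lam)%C; rewrite Cmod_mult in h5.
  have h6 : exp (Cmod t * Cmod lam) <= exp (rho * Cmod lam) by apply: exp_le_exp; nra.
  set E := exp (rho * Cmod lam) in hE h6 *.
  have h7 : Cmod (Cexp (t * lam) - 1 - t * lam)%C <= 3 * (Cmod t ^ 2 * (1 + Cmod lam) ^ 2) * E.
    apply: Rle_trans h5 _; apply: Rmult_le_compat => //; first by nra.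
    - left; exact: exp_pos.
    - rewrite Rpow_mult_distr; apply: Rmult_le_compat_l; first lra.
      apply: Rmult_le_compat_l => //; exact: pow2_ge_0.
  apply: Rle_trans (Rmult_le_compat_l _ _ _ he h7) _; right; ring.
Qed.

(** The first two terms of the exponential are removed so that the constant is
quadratic in [d]: with [d = O(1/m)] it is summable. *)
Lemma jet_exp_mid (rho : R) (d s : C) :
  0 <= rho ->
  jet rho (3 * (1 + Cmod s) ^ 2 * Cmod d ^ 2 * exp ((Cmod s + rho) * Cmod d))
    (fun t => Cexp (t * d) - 1 - t * d)%C s (d * (Cexp (s * d) - 1))%C.
Proof.
move=> hr; have hd := Cmod_ge_0 d; have hs := Cmod_ge_0 s.
have hE : exp (Cmod s * Cmod d) <= exp ((Cmod s + rho) * Cmod d).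
  by apply: exp_le_exp; nra.
have hE0 := exp_pos (Cmod s * Cmod d).
have hd2 := pow2_ge_0 (Cmod d).
split; [|split] => [||t ht].
- apply: Rle_trans (Cmod_exp_m1_mid _) _; rewrite Cmod_mult.
  apply: Rmult_le_compat => //; [nra | lra |].
  rewrite Rpow_mult_distr -Rmult_assoc; apply: Rmult_le_compat_r => //; nra.
- rewrite Cmod_mult; have h := Cmod_exp_m1 (s * d)%C; rewrite Cmod_mult in h.
  apply: Rle_trans (Rmult_le_compat_l _ _ _ hd h) _.
  have -> : Cmod d * (3 * (Cmod s * Cmod d) * exp (Cmod s * Cmod d)) =
    3 * Cmod s * Cmod d ^ 2 * exp (Cmod s * Cmod d) by ring.
  apply: Rmult_le_compat => //; [nra | lra |].
  apply: Rmult_le_compat_r => //; nra.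
- have -> : (Cexp ((s + t) * d) - 1 - (s + t) * d - (Cexp (s * d) - 1 - s * d) -
    t * (d * (Cexp (s * d) - 1)) = Cexp (s * d) * (Cexp (t * d) - 1 - t * d))%C.
    have -> : ((s + t) * d = s * d + t * d)%C by ring.
    rewrite Cexp_plus; ring.
  rewrite Cmod_mult; have ht0 := Cmod_ge_0 t.
  have h5 := Cmod_exp_m1_mid (t * d)%C; rewrite Cmod_mult in h5.
  have h6 : Cmod (Cexp (s * d)%C) <= exp (Cmod s * Cmod d).
    rewrite Cmod_Cexp -Cmod_mult; apply: exp_le_exp.
    by apply: Rle_trans (Rle_abs _) (re_le_Cmod _).
  have h7 : exp (Cmod t * Cmod d) <= exp (rho * Cmod d) by apply: exp_le_exp; nra.
  have h8 : exp ((Cmod s + rho) * Cmod d) = exp (Cmod s * Cmod d) * exp (rho * Cmod d).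
    by rewrite -exp_plus; congr exp; ring.
  have h9 : Cmod (Cexp (t * d) - 1 - t * d)%C <= 3 * (Cmod t ^ 2 * Cmod d ^ 2) * exp (rho * Cmod d).
    apply: Rle_trans h5 _; rewrite -Rpow_mult_distr.
    by apply: Rmult_le_compat_l => //; nra.
  have h10 : Cmod (Cexp (s * d)%C) * Cmod (Cexp (t * d) - 1 - t * d)%C <=
    exp (Cmod s * Cmod d) * (3 * (Cmod t ^ 2 * Cmod d ^ 2) * exp (rho * Cmod d)).
    by apply: Rmult_le_compat => //; exact: Cmod_ge_0.
  apply: Rle_trans h10 _; rewrite h8.
  have -> : exp (Cmod s * Cmod d) * (3 * (Cmod t ^ 2 * Cmod d ^ 2) * exp (rho * Cmod d)) =
    1 * (3 * Cmod d ^ 2 * (exp (Cmod s * Cmod d) * exp (rho * Cmod d)) * Cmod t ^ 2) by ring.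
  have -> : 3 * (1 + Cmod s) ^ 2 * Cmod d ^ 2 * (exp (Cmod s * Cmod d) * exp (rho * Cmod d)) * Cmod t ^ 2
   = (1 + Cmod s) ^ 2 * (3 * Cmod d ^ 2 * (exp (Cmod s * Cmod d) * exp (rho * Cmod d)) * Cmod t ^ 2) by ring.
  apply: Rmult_le_compat_r; last by nra.
  apply: Rmult_le_pos; last exact: pow2_ge_0.
  apply: Rmult_le_pos; first by nra.
  apply: Rmult_le_pos; left; exact: exp_pos.
Qed.

(** The sum of a series as a total function, meaningful when the series converges. *)
Definition Csum (u : nat -> C) : C :=
  epsilon (inhabits (RtoC 0)) (fun S => @is_series C_AbsRing C_NormedModule u S).

Lemma Csum_correct (u : nat -> C) (b : nat -> R) :
  (forall m, Cmod (u m) <= b m) -> ex_series b ->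
  @is_series C_AbsRing C_NormedModule u (Csum u).
Proof.
move=> h hb; apply: epsilon_spec.
exact: (@ex_series_le C_AbsRing C_CompleteNormedModule u b h hb).
Qed.

Lemma Cmod_series_le (u : nat -> C) (U : C) (b : nat -> R) (B : R) :
  (forall m, Cmod (u m) <= b m) -> is_series b B ->
  @is_series C_AbsRing C_NormedModule u U -> Cmod U <= B.
Proof.
move=> h hb /is_series_C hu.
have hn : forall N, Cmod (sum_n u N) <= sum_n b N.
  elim=> [|N IH]; first by rewrite !sum_O.
  rewrite !sum_Sn; apply: Rle_trans (Cmod_triangle _ _) _.
  exact: Rplus_le_compat.
apply: (is_lim_seq_le (fun _ => Cmod U) (fun N => sum_n b N + Cmod (sum_n u N - U)%C) (Cmod U) B).
- move=> N; have -> : U = (sum_n u N + - (sum_n u N - U))%C by ring.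
  apply: Rle_trans (Cmod_triangle _ _) _; rewrite Cmod_opp.
  have -> : (sum_n u N + - (sum_n u N - U) = U)%C by ring.
  have := hn N; lra.
- exact: is_lim_seq_const.
- rewrite -(Rplus_0_r B); exact: is_lim_seq_plus'.
Qed.

Lemma jet_series (rho : R) (K : nat -> R) (f : nat -> C -> C) (s : C) (l : nat -> C) :
  0 <= rho <= 1 -> (forall m, jet rho (K m) (f m) s (l m)) -> ex_series K ->
  jet rho (Series K) (fun t => Csum (fun m => f m t)) s (Csum l).
Proof.
move=> hr hj hK; have hS := Series_correct _ hK.
have hl : @is_series C_AbsRing C_NormedModule l (Csum l).
  by apply: (Csum_correct _ K) => // m; case: (hj m) => _ [].
have hf : @is_series C_AbsRing C_NormedModule (fun m => f m s) (Csum (fun m => f m s)).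
  by apply: (Csum_correct _ K) => // m; case: (hj m).
split; [|split].
- by apply: (Cmod_series_le _ _ _ _ _ hS hf) => m; case: (hj m).
- by apply: (Cmod_series_le _ _ _ _ _ hS hl) => m; case: (hj m) => _ [].
- move=> t ht.
  have hft : @is_series C_AbsRing C_NormedModule (fun m => f m (s + t)%C) (Csum (fun m => f m (s + t)%C)).
    apply: (Csum_correct _ (fun m => 3 * K m)).
    + by move=> m; apply: (jet_bound rho _ _ _ _ _ _ (hj m)); lra.
    + exact: ex_series_scal_l.
  rewrite Rmult_comm.
  have hd := is_series_minus _ _ _ _ (is_series_minus _ _ _ _ hft hf) (is_series_scal t _ _ hl).
  apply: (Cmod_series_le _ _ _ _ _ (is_series_scal_l (Cmod t ^ 2) _ _ hS) hd) => m.
  have [_ [_ h]] := hj m; have := h t ht; rewrite Rmult_comm; exact.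
Qed.

(** * Alternating sums by repeated averaging *)

Definition diff2 (u : nat -> C) (m : nat) : C := (u m - RtoC 2 * u (S m) + u (S (S m)))%C.

Definition altsum (u : nat -> C) (N : nat) : C :=
  sum_n (fun m => (RtoC (-1) ^ m * u m)%C : C_NormedModule) N.

(** Minus the averaged value of the terms of index above [N], up to second
differences. *)
Definition alttail (u : nat -> C) (N : nat) : C :=
  (RtoC (-1) ^ N * ((RtoC 3 * u (S N) - u (S (S N))) / RtoC 4))%C.

(** The partial sums corrected by [alttail]: they converge for sequences growing
like a logarithm, although the alternating sum diverges. *)
Definition regsum (u : nat -> C) (N : nat) : C := (altsum u N - alttail u N)%C.

Lemma altsum_S (u : nat -> C) (N : nat) :
  altsum u (S N) = (altsum u N + RtoC (-1) ^ S N * u (S N))%C.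
Proof. by rewrite /altsum sum_Sn. Qed.

Lemma RtoC4_neq_0 : RtoC 4 <> RtoC 0.
Proof. by move/RtoC_inj; lra. Qed.

(** The expansion of [1 / (1 + E)] to second order, [E] being the shift, applied
at 0 for the whole sum and at [N + 1] for its tail. *)
Lemma altsum_diff2 (u : nat -> C) (N : nat) :
  altsum u N = ((RtoC 3 * u 0%nat - u 1%nat + altsum (diff2 u) N) / RtoC 4 + alttail u N)%C.
Proof.
elim: N => [|N IH].
  rewrite /altsum !sum_O /alttail /diff2 /=; field; exact: RtoC4_neq_0.
rewrite !altsum_S IH /alttail /diff2 /=; field; exact: RtoC4_neq_0.
Qed.

Lemma Cmod_sign (m : nat) : Cmod (RtoC (-1) ^ m)%C = 1.
Proof. by rewrite Cmod_pow Cmod_R Rabs_Ropp Rabs_R1 pow1. Qed.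

Lemma regsum_plus (u v : nat -> C) (N : nat) :
  regsum (fun m => u m + v m)%C N = (regsum u N + regsum v N)%C.
Proof.
rewrite /regsum.
have -> : altsum (fun m => u m + v m)%C N = (altsum u N + altsum v N)%C.
  elim: N => [|N IH]; last by rewrite !altsum_S IH; ring.
  rewrite /altsum !sum_O; ring.
rewrite /alttail; field; exact: RtoC4_neq_0.
Qed.

Lemma regsum_zero (N : nat) : regsum (fun _ => RtoC 0) N = RtoC 0.
Proof.
rewrite /regsum.
have -> : altsum (fun _ => RtoC 0) N = RtoC 0.
  elim: N => [|N IH]; last by rewrite !altsum_S IH; ring.
  rewrite /altsum !sum_O; ring.
rewrite /alttail; field; exact: RtoC4_neq_0.
Qed.

Lemma regsum_opp (u : nat -> C) (N : nat) :
  regsum (fun m => - u m)%C N = (- regsum u N)%C.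
Proof.
have := regsum_plus u (fun m => - u m)%C N.
have -> : regsum (fun m => u m + - u m)%C N = RtoC 0.
  rewrite -(regsum_zero N) /regsum /alttail; congr (_ - _)%C; last first.
    field; exact: RtoC4_neq_0.
  by apply: sum_n_ext => m; have -> : (u m + - u m = RtoC 0)%C by ring.
move=> h; transitivity (- regsum u N + (regsum u N + regsum (fun m => - u m) N))%C; first ring.
rewrite -h; ring.
Qed.

Lemma sign_even (M : nat) : (RtoC (-1) ^ (2 * M)%coq_nat)%C = RtoC 1.
Proof.
elim: M => // M IH; have -> : (2 * S M)%coq_nat = S (S (2 * M)%coq_nat) by lia.
have -> : (RtoC (-1) ^ S (S (2 * M)%coq_nat) = RtoC (-1) ^ (2 * M)%coq_nat)%C.
  rewrite /=; ring.
exact: IH.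
Qed.

(** The value of [(m + 1)^(-3/2)]: the exponent is [-2] from the second
differences, plus [1/2] which leaves room for the growth of [exp(- s L_m)]. *)
Definition weight (m : nat) : R := / ((INR m + 1) * sqrt (INR m + 1)).

(** Comparison with the telescoping series of [6 (m + 1)^(-1/2)]. *)
Lemma ex_series_weight : ex_series weight.
Proof.
have hw m : 0 < weight m.
  have h := pos_INR m; apply: Rinv_0_lt_compat; apply: Rmult_lt_0_compat; first lra.
  apply: sqrt_lt_R0; lra.
have hstep m : weight m <= 6 * (/ sqrt (INR m + 1) - / sqrt (INR (S m) + 1)).
  have h := pos_INR m; rewrite S_INR /weight.
  have ha := sqrt_sqrt (INR m + 1) ltac:(lra).
  have hb := sqrt_sqrt (INR m + 1 + 1) ltac:(lra).
  have pa : 0 < sqrt (INR m + 1) by apply: sqrt_lt_R0; lra.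
  have pb : 0 < sqrt (INR m + 1 + 1) by apply: sqrt_lt_R0; lra.
  set a := sqrt (INR m + 1) in ha pa *; set b := sqrt (INR m + 1 + 1) in hb pb *.
  have hb2 : b <= 2 * a by nra.
  have hab : a <= b by nra.
  have -> : / a - / b = / (a * b * (a + b)).
    have e : (b - a) * (a + b) = 1 by nra.
    field_simplify_eq; [nra | lra].
  have -> : 6 * / (a * b * (a + b)) = / (a * b * (a + b) / 6) by field; nra.
  apply: Rinv_le_contravar; first by nra.
  have h1 : b * (a + b) <= 6 * (a * a) by nra.
  rewrite -ha; nra.
apply/(ex_finite_lim_seq_incr (sum_n weight) 6) => N.
- rewrite sum_Sn -[plus _ _]/(sum_n weight N + weight (S N)); have := hw (S N); lra.
- apply: Rle_trans (_ : _ <= 6 * (1 - / sqrt (INR (S N) + 1))) _.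
    elim: N => [|N IH]; last by rewrite sum_Sn; have := hstep (S N); rewrite -[plus _ _]/(sum_n weight N + weight (S N)); lra.
    by rewrite sum_O; have := hstep 0%nat; rewrite Rplus_0_l sqrt_1 Rinv_1.
  have : 0 < / sqrt (INR (S N) + 1).
    apply: Rinv_0_lt_compat; apply: sqrt_lt_R0; have := pos_INR (S N); lra.
  lra.
Qed.

(** * Sequences behaving like a multiple of the logarithm *)

(** The features of [k ln m] on which the continuation rests. The bounds hold for
all [m], with [A] absorbing the first terms, so that such sequences can be added
without keeping track of thresholds. *)
Record log_like (k : R) (L : nat -> C) (A : R) : Prop := LogLike {
  log_like_ge0 : 0 <= A;
  log_like_diff : forall m, Cmod (L (S m) - L m)%C <= A / (INR m + 1);
  log_like_diff2 : forall m, Cmod (diff2 L m) <= A / (INR m + 1) ^ 2;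
  log_like_Re : forall m, k * ln (INR m + 1) - A <= Re (L m);
  log_like_Im : forall m, Rabs (Im (L m)) <= A }.

Lemma ln_le_m1 (y : R) : 0 < y -> ln y <= y - 1.
Proof. by move=> hy; have := exp_ineq1_le (ln y); rewrite exp_ln //; lra. Qed.

Lemma ln_step (y : R) : 0 < y -> / (y + 1) <= ln (y + 1) - ln y <= / y.
Proof.
move=> hy; rewrite -ln_div; try lra.
have -> : ln ((y + 1) / y) = - ln (y / (y + 1)).
  rewrite -ln_Rinv; last by apply: Rdiv_lt_0_compat; lra.
  by congr ln; field; lra.
split.
- have := ln_le_m1 (y / (y + 1)) ltac:(apply: Rdiv_lt_0_compat; lra).
  have -> : y / (y + 1) - 1 = - / (y + 1) by field; lra.
  lra.
- have -> : - ln (y / (y + 1)) = ln ((y + 1) / y).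
    rewrite -ln_Rinv; last by apply: Rdiv_lt_0_compat; lra.
    by congr ln; field; lra.
  have := ln_le_m1 ((y + 1) / y) ltac:(apply: Rdiv_lt_0_compat; lra).
  have -> : (y + 1) / y - 1 = / y by field; lra.
  lra.
Qed.

Lemma log_like_Cmod (k A : R) (L : nat -> C) (m : nat) :
  log_like k L A -> Cmod (L m) <= Cmod (L 0%nat) + 2 * A * ln (INR m + 1).
Proof.
move=> [hA hd _ _ _]; elim: m => [|m IH]; first by rewrite /= Rplus_0_l ln_1; lra.
have h := pos_INR m.
have -> : L (S m) = (L m + (L (S m) - L m))%C by ring.
apply: Rle_trans (Cmod_triangle _ _) _.
have h1 := hd m; have [h2 _] := ln_step (INR m + 1) ltac:(lra).
have h3 : A / (INR m + 1) <= 2 * A * / (INR m + 1 + 1).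
  have -> : 2 * A * / (INR m + 1 + 1) = A * / ((INR m + 1 + 1) / 2) by field; lra.
  apply: Rmult_le_compat_l => //; apply: Rinv_le_contravar; lra.
rewrite S_INR; nra.
Qed.

Lemma exp_half_ln (y : R) : 0 < y -> exp (/ 2 * ln y) = sqrt y.
Proof. by move=> hy; rewrite -Rpower_sqrt. Qed.

(** Here the radius of the disc around 0 is chosen, so small that powers
[exp (rho |L_m|)] grow more slowly than [sqrt m]. *)
Lemma log_like_growth (k A : R) (L : nat -> C) :
  log_like k L A ->
  exists rho B : R, 0 < rho <= 1 /\ 0 <= B /\
    forall m, exp (3 * rho * Cmod (L (S m))) <= B * sqrt (INR m + 1).
Proof.
move=> hL; have hA := log_like_ge0 _ _ _ hL.
(* [|L_m|] is at most [|L_0| + 2 A ln (m + 1)], so [6 rho A <= 1/2] is needed. *)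
exists (/ (12 * (A + 1))), (exp (3 * / (12 * (A + 1)) * Cmod (L 0%nat)) * 2).
have hr : 0 < / (12 * (A + 1)) by apply: Rinv_0_lt_compat; lra.
split; [split => // |split].
- rewrite -Rinv_1; apply: Rinv_le_contravar; lra.
- have := exp_pos (3 * / (12 * (A + 1)) * Cmod (L 0%nat)); lra.
- move=> m; have h := pos_INR m.
  have hl : 0 <= ln (INR (S m) + 1) by rewrite -ln_1; apply: ln_le; rewrite ?S_INR; lra.
  have h1 := log_like_Cmod _ _ _ (S m) hL.
  set r := / (12 * (A + 1)) in hr *.
  have hrA : 6 * r * A <= / 2.
    have : r * (12 * (A + 1)) = 1 by rewrite /r; field; lra.
    nra.
  have h2 : 3 * r * Cmod (L (S m)) <= 3 * r * Cmod (L 0%nat) + / 2 * ln (INR (S m) + 1).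
    have : 3 * r * Cmod (L (S m)) <= 3 * r * (Cmod (L 0%nat) + 2 * A * ln (INR (S m) + 1)).
      by apply: Rmult_le_compat_l; lra.
    have : 6 * r * A * ln (INR (S m) + 1) <= / 2 * ln (INR (S m) + 1) by apply: Rmult_le_compat_r.
    lra.
  apply: Rle_trans (exp_le_exp _ _ h2) _.
  rewrite exp_plus (Rmult_assoc (exp _)) exp_half_ln; last by rewrite S_INR; lra.
  apply: Rmult_le_compat_l; first by left; exact: exp_pos.
  rewrite S_INR.
  have ha := sqrt_sqrt (INR m + 1) ltac:(lra).
  have hb := sqrt_sqrt (INR m + 1 + 1) ltac:(lra).
  have pa : 0 < sqrt (INR m + 1) by apply: sqrt_lt_R0; lra.
  have pb : 0 < sqrt (INR m + 1 + 1) by apply: sqrt_lt_R0; lra.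
  nra.
Qed.

Definition exp_terms (L : nat -> C) (t : C) (m : nat) : C := Cexp (t * - L m)%C.

(** The factor in parentheses is a second difference with the dominant size
[exp(- t L_(m+1))] taken out. It is cut into three pieces, each of which is
[O(1/m^2)]: two exponentials without their affine parts, and a second
difference of [L]. *)
Lemma diff2_exp_terms (L : nat -> C) (t : C) (m : nat) :
  diff2 (exp_terms L t) m =
  (Cexp (t * - L (S m)) *
    ((Cexp (t * (L (S m) - L m)) - 1 - t * (L (S m) - L m)) +
     ((Cexp (t * (L (S m) - L (S (S m)))) - 1 - t * (L (S m) - L (S (S m)))) +
       t * - diff2 L m)))%C.
Proof.
rewrite /diff2 /exp_terms.
have -> : (t * - L m = t * - L (S m) + t * (L (S m) - L m))%C by ring.
have -> : (t * - L (S (S m)) = t * - L (S m) + t * (L (S m) - L (S (S m))))%C by ring.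
rewrite !Cexp_plus; ring.
Qed.

Lemma Cmod_exp_terms (k A : R) (L : nat -> C) (s : C) (m : nat) :
  log_like k L A -> 0 <= Re s ->
  Cmod (exp_terms L s m) <= exp ((Re s + Rabs (Im s)) * A - Re s * k * ln (INR m + 1)).
Proof.
move=> [hA _ _ hr hi] hs; rewrite Cmod_Cexp; apply: exp_le_exp.
have -> : Re (s * - L m)%C = Im s * Im (L m) - Re s * Re (L m) by rewrite /Re /Im /=; ring.
have h1 := Rle_abs (Im s * Im (L m)); rewrite Rabs_mult in h1.
have h2 : Rabs (Im s) * Rabs (Im (L m)) <= Rabs (Im s) * A.
  by apply: Rmult_le_compat_l => //; exact: Rabs_pos.
have := Rmult_le_compat_l _ _ _ hs (hr m); lra.
Qed.

(** The main estimate: at all points of the half-plane and of the disc, the second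
differences of [exp(- s L_m)] are summable together with their expansions.
In the exponential factor, [exp (rho |L|)] is spent three times: on the
value [exp (- s L)], on the displacement [t], and on the factor [(1 + |L|)^2]. *)
Lemma jet_diff2 (k A : R) (L : nat -> C) :
  0 <= k -> log_like k L A ->
  exists rho : R, 0 < rho <= 1 /\
    forall s : C, 0 < Re s \/ Cmod s < rho -> exists K : R,
      forall m, jet rho (K * weight m) (fun t => diff2 (exp_terms L t) m) s
        (diff2 (fun i => - L i * exp_terms L s i)%C m).
Proof.
move=> hk hL; have [rho [B [hr [hB hgrow]]]] := log_like_growth _ _ _ hL.
have hA := log_like_ge0 _ _ _ hL.
exists rho; split=> // s hs.
have [c hc] : exists c, forall m, Cmod (exp_terms L s m) <= exp c * exp (rho * Cmod (L m)).
  exists ((Rabs (Re s) + Rabs (Im s)) * A) => m.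
  have hn0 : 0 <= (Rabs (Re s) + Rabs (Im s)) * A.
    apply: Rmult_le_pos => //; have := Rabs_pos (Re s); have := Rabs_pos (Im s); lra.
  rewrite -exp_plus; case: hs => hs.
  - apply: Rle_trans (Cmod_exp_terms _ _ _ _ _ hL (Rlt_le _ _ hs)) _.
    rewrite (Rabs_pos_eq (Re s)); last lra.
    apply: exp_le_exp.
    have hl : 0 <= ln (INR m + 1).
      by rewrite -ln_1; apply: ln_le; have := pos_INR m; lra.
    have : 0 <= Re s * k * ln (INR m + 1) by apply: Rmult_le_pos => //; apply: Rmult_le_pos; lra.
    have : 0 <= rho * Cmod (L m) by apply: Rmult_le_pos; [lra | exact: Cmod_ge_0].
    lra.
  - rewrite Cmod_Cexp; apply: exp_le_exp.
    have := Rle_trans _ _ _ (Rle_abs _) (re_le_Cmod (s * - L m)%C).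
    rewrite Cmod_mult Cmod_opp => h.
    have : Cmod s * Cmod (L m) <= rho * Cmod (L m).
      by apply: Rmult_le_compat_r; [exact: Cmod_ge_0 | lra].
    lra.
pose M1 := 3 * exp c * (4 / rho ^ 2) * B.
pose M2 := 6 * (1 + Cmod s) ^ 2 * A ^ 2 * exp ((Cmod s + rho) * A) + (1 + Cmod s) * A.
exists (6 * M1 * M2) => m.
have hm := pos_INR m; have hs0 := Cmod_ge_0 s.
set d := (L (S m) - L m)%C; set d' := (L (S m) - L (S (S m)))%C.
have hd : Cmod d <= A / (INR m + 1) by exact: log_like_diff hL m.
have hd' : Cmod d' <= A / (INR m + 1).
  have -> : d' = (- (L (S (S m)) - L (S m)))%C by rewrite /d'; ring.
  rewrite Cmod_opp; apply: Rle_trans (log_like_diff _ _ _ hL (S m)) _.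
  apply: Rmult_le_compat_l => //; apply: Rinv_le_contravar; rewrite ?S_INR; lra.
have hA1 : A / (INR m + 1) <= A.
  rewrite -[X in _ <= X]Rmult_1_r; apply: Rmult_le_compat_l => //.
  rewrite -Rinv_1; apply: Rinv_le_contravar; lra.
have hmid : forall x, Cmod x <= A / (INR m + 1) ->
  3 * (1 + Cmod s) ^ 2 * Cmod x ^ 2 * exp ((Cmod s + rho) * Cmod x) <=
  3 * (1 + Cmod s) ^ 2 * A ^ 2 * exp ((Cmod s + rho) * A) * / (INR m + 1) ^ 2.
  move=> x hx; have hx0 := Cmod_ge_0 x.
  have -> : 3 * (1 + Cmod s) ^ 2 * A ^ 2 * exp ((Cmod s + rho) * A) * / (INR m + 1) ^ 2 =
     3 * (1 + Cmod s) ^ 2 * (A / (INR m + 1)) ^ 2 * exp ((Cmod s + rho) * A).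
    by field; lra.
  apply: Rmult_le_compat; [nra | left; exact: exp_pos | |].
  - apply: Rmult_le_compat_l; first nra.
    by apply: pow_incr.
  - apply: exp_le_exp; apply: Rmult_le_compat_l; lra.
apply: jet_ext (fun t => esym (diff2_exp_terms L t m)) _.
have jl : jet rho ((1 + Cmod s) * A * / (INR m + 1) ^ 2) (fun t => t * - diff2 L m)%C s (- diff2 L m)%C.
  apply: jet_le (jet_linear rho (- diff2 L m)%C s).
  rewrite Cmod_opp Rmult_assoc; apply: Rmult_le_compat_l; first lra.
  exact: log_like_diff2 hL m.
have j1 := jet_le _ _ _ _ _ _ (hmid d hd) (jet_exp_mid rho d s ltac:(lra)).
have j2 := jet_le _ _ _ _ _ _ (hmid d' hd') (jet_exp_mid rho d' s ltac:(lra)).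
have j3 := jet_plus _ _ _ _ _ _ _ _ j1 (jet_plus _ _ _ _ _ _ _ _ j2 jl).
have je : jet rho (M1 * sqrt (INR m + 1)) (fun t => Cexp (t * - L (S m))%C) s
   (- L (S m) * Cexp (s * - L (S m)))%C.
  apply: jet_le (jet_exp rho (- L (S m))%C s ltac:(lra)).
  rewrite Cmod_opp.
  set u := Cmod (L (S m)); have hu : 0 <= u by exact: Cmod_ge_0.
  have hsq : (1 + u) ^ 2 <= 4 / rho ^ 2 * exp (rho * u).
    have h1 := exp_ineq1_le (rho / 2 * u).
    have -> : exp (rho * u) = exp (rho / 2 * u) ^ 2.
      by rewrite /= Rmult_1_r -exp_plus; congr exp; field.
    have -> : 4 / rho ^ 2 * exp (rho / 2 * u) ^ 2 = (2 / rho * exp (rho / 2 * u)) ^ 2 by field; lra.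
    apply: pow_incr; split; first lra.
    apply: Rle_trans (_ : _ <= 2 / rho * (1 + rho / 2 * u)) _.
      have -> : 2 / rho * (1 + rho / 2 * u) = 2 / rho + u by field; lra.
      have : 1 <= 2 / rho by apply: (Rmult_le_reg_r rho); [lra | field_simplify; lra].
      lra.
    apply: Rmult_le_compat_l => //; left; apply: Rdiv_lt_0_compat; lra.
  have hcm := hc (S m); rewrite -/u in hcm.
  have hp : Cmod (exp_terms L s (S m)) * (1 + u) ^ 2 <=
    (exp c * exp (rho * u)) * (4 / rho ^ 2 * exp (rho * u)).
    by apply: Rmult_le_compat => //; [exact: Cmod_ge_0 | nra].
  have he : 0 <= exp (rho * u) by left; exact: exp_pos.
  have hp2 := Rmult_le_compat_r _ _ _ he hp.
  have hg := hgrow m; rewrite -/u in hg.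
  have e3 : exp (3 * rho * u) = exp (rho * u) * exp (rho * u) * exp (rho * u).
    by rewrite -!exp_plus; congr exp; ring.
  have hC : 0 <= 3 * exp c * (4 / rho ^ 2).
    apply: Rmult_le_pos; first by have := exp_pos c; lra.
    left; apply: Rdiv_lt_0_compat; nra.
  have hg2 := Rmult_le_compat_l _ _ _ hC hg; rewrite e3 in hg2.
  rewrite /M1 -/(exp_terms L s (S m)); lra.
have jj := jet_mult _ _ _ _ _ _ _ _ (proj2 hr) je j3.
have -> : diff2 (fun i => - L i * exp_terms L s i)%C m =
  (- L (S m) * Cexp (s * - L (S m)) *
    ((Cexp (s * d) - 1 - s * d) + ((Cexp (s * d') - 1 - s * d') + s * - diff2 L m)) +
   Cexp (s * - L (S m)) *
    (d * (Cexp (s * d) - 1) + (d' * (Cexp (s * d') - 1) + - diff2 L m)))%C.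
  rewrite /diff2 /exp_terms.
  have -> : (s * - L m = s * - L (S m) + s * d)%C by rewrite /d; ring.
  have -> : (s * - L (S (S m)) = s * - L (S m) + s * d')%C by rewrite /d'; ring.
  rewrite !Cexp_plus /d /d'; ring.
apply: jet_le jj.
right; rewrite /M2 /weight.
have hq : 0 < sqrt (INR m + 1) by apply: sqrt_lt_R0; lra.
have -> : / (INR m + 1) ^ 2 = / ((INR m + 1) * (sqrt (INR m + 1) * sqrt (INR m + 1))).
  by rewrite sqrt_sqrt; [field; lra | lra].
field; lra.
Qed.

(** * The continuation and its derivative at the origin *)

Lemma is_lim_seq_ln_succ : is_lim_seq (fun m => ln (INR m + 1)) p_infty.
Proof.
apply: (is_lim_comp_seq ln _ p_infty) is_lim_ln_p _ _; first by exists 0%nat.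
have h := proj1 (is_lim_seq_incr_1 _ _) is_lim_seq_INR.
by apply: is_lim_seq_ext h => m; rewrite S_INR.
Qed.

Lemma exp_terms_cvg0 (k A : R) (L : nat -> C) (s : C) :
  0 < k -> log_like k L A -> 0 < Re s -> cvgC (exp_terms L s) 0%C.
Proof.
move=> hk hL hs.
apply: (cvgC_le _ _ (fun m => exp ((Re s + Rabs (Im s)) * A - Re s * k * ln (INR m + 1)))).
  move=> m; have -> : (exp_terms L s m - 0 = exp_terms L s m)%C by ring.
  by apply: Cmod_exp_terms hL _; lra.
apply: (is_lim_comp_seq exp _ m_infty) is_lim_exp_m _ _; first by exists 0%nat.
apply: (is_lim_seq_ext (fun m => (Re s + Rabs (Im s)) * A + (- (Re s * k)) * ln (INR m + 1))).
  by move=> m; ring.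
apply: (is_lim_seq_plus _ _ ((Re s + Rabs (Im s)) * A) m_infty).
- exact: is_lim_seq_const.
- have h := is_lim_seq_scal_l _ (- (Re s * k)) _ is_lim_seq_ln_succ.
  have hneg : - (Re s * k) < 0 by have := Rmult_lt_0_compat _ _ hs hk; lra.
  suff <- : Rbar_mult (- (Re s * k)) p_infty = m_infty by [].
  rewrite /Rbar_mult /Rbar_mult' /=; case: Rle_dec => h1 //; exfalso; lra.
- by [].
Qed.

Lemma alttail_cvg0 (u : nat -> C) : cvgC u 0%C -> cvgC (alttail u) 0%C.
Proof.
move=> hu.
have h1 : cvgC (fun N => u (S N)) 0%C by apply: cvgC_sub hu; apply: eventually_subseq => n; lia.
have h2 : cvgC (fun N => u (S (S N))) 0%C by apply: cvgC_sub hu; apply: eventually_subseq => n; lia.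
have := cvgC_plus _ _ _ _ (cvgC_mult _ _ _ _ (cvgC_const (RtoC 3 / RtoC 4)%C) h1)
  (cvgC_mult _ _ _ _ (cvgC_const (- / RtoC 4)%C) h2).
have -> : (RtoC 3 / RtoC 4 * 0 + - / RtoC 4 * 0 = 0)%C by ring.
apply: is_lim_seq_ext => N.
have -> : (alttail u N - 0)%C = (RtoC (-1) ^ N * (RtoC 3 / RtoC 4 * u (S N) + - / RtoC 4 * u (S (S N)) - 0))%C.
  by rewrite /alttail; field; exact: RtoC4_neq_0.
by rewrite [in RHS]Cmod_mult Cmod_sign Rmult_1_l.
Qed.

Lemma altsum_regularized (u : nat -> C) (S : C) :
  cvgC (altsum (diff2 u)) S ->
  cvgC (regsum u) ((RtoC 3 * u 0%nat - u 1%nat + S) / RtoC 4)%C.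
Proof.
move=> h.
have := cvgC_mult _ _ _ _ (cvgC_plus _ _ _ _ (cvgC_const (RtoC 3 * u 0%nat - u 1%nat)%C) h) (cvgC_const (/ RtoC 4)%C).
by apply: cvgC_ext => N; rewrite /regsum (altsum_diff2 u) /Cdiv; ring.
Qed.

(** [G] is the averaged series.  For [Re s > 0] the terms tend to 0, hence so does
[alttail], and [G s] is the sum of the original series.  At [s = 0] the
derivatives of the terms are the [- L m], and averaging them is exactly what
[regsum] does. *)
Lemma exp_terms_continuation (k A : R) (L : nat -> C) :
  0 < k -> log_like k L A ->
  exists (G : C -> C) (l : C),
    is_alt_continuation (fun m s => exp_terms L s m) G /\
    @is_derive C_AbsRing C_NormedModule G (RtoC 0) l /\
    cvgC (regsum (fun m => - L m)%C) l.
Proof.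
move=> hk hL; have [rho [hr hj]] := jet_diff2 k A L (Rlt_le _ _ hk) hL.
pose G := fun t : C => (/ RtoC 4 * (RtoC 3 * exp_terms L t 0 + ((- RtoC 1) * exp_terms L t 1
  + Csum (fun m => RtoC (-1) ^ m * diff2 (exp_terms L t) m))))%C.
have hseries (s : C) : 0 < Re s \/ Cmod s < rho ->
  (exists K, jet rho K G s
    (/ RtoC 4 * (RtoC 3 * (- L 0%nat * exp_terms L s 0) + ((- RtoC 1) * (- L 1%nat * exp_terms L s 1)
     + Csum (fun m => RtoC (-1) ^ m * diff2 (fun i => - L i * exp_terms L s i) m))))%C) /\
  cvgC (altsum (diff2 (exp_terms L s))) (Csum (fun m => RtoC (-1) ^ m * diff2 (exp_terms L s) m)%C) /\
  cvgC (altsum (diff2 (fun i => - L i * exp_terms L s i)%C))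
     (Csum (fun m => RtoC (-1) ^ m * diff2 (fun i => - L i * exp_terms L s i) m)%C).
  move=> hs; have [K hK] := hj s hs.
  have hw : ex_series (fun m => K * weight m).
    by apply: (@ex_series_scal_l R_AbsRing); exact: ex_series_weight.
  have hK' m := jet_scal _ _ (RtoC (-1) ^ m)%C _ _ _ (hK m).
  have {}hK' m : jet rho (K * weight m) (fun t => RtoC (-1) ^ m * diff2 (exp_terms L t) m)%C s
     (RtoC (-1) ^ m * diff2 (fun i => - L i * exp_terms L s i) m)%C.
    by have := hK' m; rewrite Cmod_sign Rmult_1_l.
  have hr' : 0 <= rho <= 1 by lra.
  have hsum := jet_series _ _ _ _ _ hr' hK' hw.
  have h0 := jet_exp rho (- L 0%nat)%C s (proj1 hr').
  have h1 := jet_exp rho (- L 1%nat)%C s (proj1 hr').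
  split; [|split].
  - have hG := jet_scal _ _ (/ RtoC 4)%C _ _ _ (jet_plus _ _ _ _ _ _ _ _ (jet_scal _ _ (RtoC 3) _ _ _ h0)
      (jet_plus _ _ _ _ _ _ _ _ (jet_scal _ _ (- RtoC 1)%C _ _ _ h1) hsum)).
    by eexists; exact: hG.
  - apply/is_series_C; apply: (Csum_correct _ (fun m => K * weight m)) => // m.
    by case: (hK' m).
  - apply/is_series_C; apply: (Csum_correct _ (fun m => K * weight m)) => // m.
    by case: (hK' m) => _ [].
have h00 : 0 < Re (RtoC 0) \/ Cmod (RtoC 0) < rho by right; rewrite Cmod_0; lra.
have [[K0 hK0] [_ hL0]] := hseries _ h00.
eexists G, _; split; [split | split; first exact: jet_is_derive (proj1 hr) hK0].
- move=> s hs; have [_ [hF _]] := hseries s (or_introl hs).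
  apply/is_series_C.
  have h1 := altsum_regularized _ _ hF.
  have h2 := alttail_cvg0 _ (exp_terms_cvg0 _ _ _ _ hk hL hs).
  have := cvgC_plus _ _ _ _ h1 h2; rewrite /regsum.
  have -> : ((RtoC 3 * exp_terms L s 0 - exp_terms L s 1 + Csum (fun m => RtoC (-1) ^ m * diff2 (exp_terms L s) m)) / RtoC 4 + 0 = G s)%C.
    by rewrite /G; field; exact: RtoC4_neq_0.
  by apply: cvgC_ext => N; transitivity (altsum (exp_terms L s) N); first ring.
- exists (mkposreal _ (proj1 hr)) => s hs; have [[K hK] _] := hseries s hs.
  by eexists; exact: jet_is_derive (proj1 hr) hK.
- have e0 : forall i, (- L i)%C = (- L i * exp_terms L (RtoC 0) i)%C.
    by move=> i; rewrite /exp_terms Cmult_0_l Cexp_0 Cmult_1_r.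
  have := altsum_regularized _ _ hL0.
  set S := Csum _.
  have -> : (/ RtoC 4 * (RtoC 3 * (- L 0%nat * exp_terms L 0 0) + (- RtoC 1 * (- L 1%nat * exp_terms L 0 1) + S)) =
    (RtoC 3 * (- L 0%nat * exp_terms L 0 0) - - L 1%nat * exp_terms L 0 1 + S) / RtoC 4)%C.
    by field; exact: RtoC4_neq_0.
  apply: cvgC_ext => N; rewrite /regsum /alttail -!e0; congr Cminus.
  by apply: sum_n_ext => m; rewrite -e0.
Qed.

(** If [E + t d] is at most [eps t] at both [t = r/3] and [t = 2r/3], subtraction
eliminates [E] and bounds [|d|] by [3 eps]. *)
Lemma derive_0_unique (G H : C -> C) (l m : C) :
  (forall s : C, 0 < Re s -> G s = H s) ->
  @is_derive C_AbsRing C_NormedModule G (RtoC 0) l ->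
  @is_derive C_AbsRing C_NormedModule H (RtoC 0) m -> l = m.
Proof.
move=> hGH hG hH; have [_ hd] := is_derive_minus _ _ _ _ _ hG hH.
have {}hd := hd (RtoC 0) (fun P h => h).
set E := (G (RtoC 0) - H (RtoC 0))%C; set d := (l - m)%C.
have key (eps : posreal) : Cmod d <= 3 * eps.
  have [r hr] := hd eps.
  have hE (t : R) : 0 < t < r -> Cmod (E + RtoC t * d)%C <= eps * t.
    move=> ht.
    have hb : @ball (AbsRing_UniformSpace C_AbsRing) (RtoC 0) r (RtoC t).
      rewrite ball_C_abs -RtoC_minus Rminus_0_r Cmod_R Rabs_pos_eq; lra.
    have := hr (RtoC t) hb.
    change (Cmod (G t - H t - (G (RtoC 0) - H (RtoC 0)) - (RtoC t - RtoC 0) * (l - m))%C <=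
       eps * Cmod (RtoC t - RtoC 0)%C -> Cmod (E + RtoC t * d)%C <= eps * t).
    rewrite (hGH (RtoC t)) /=; last lra.
    have -> : (H t - H t - (G (RtoC 0) - H (RtoC 0)) - (RtoC t - RtoC 0) * (l - m) = - (E + RtoC t * d))%C.
      rewrite /E /d; ring.
    rewrite Cmod_opp -RtoC_minus Rminus_0_r (Cmod_R t) Rabs_pos_eq //; lra.
  have hr0 := cond_pos r.
  have h1 := hE (r / 3) ltac:(lra); have h2 := hE (2 * (r / 3)) ltac:(lra).
  have h3 : Cmod (RtoC (r / 3) * d)%C <= 3 * eps * (r / 3).
    have -> : (RtoC (r / 3) * d = (E + RtoC (2 * (r / 3)) * d) + - (E + RtoC (r / 3) * d))%C.
      rewrite RtoC_mult; ring.
    apply: Rle_trans (Cmod_triangle _ _) _; rewrite Cmod_opp; lra.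
  rewrite Cmod_mult Cmod_R Rabs_pos_eq in h3; last lra.
  apply: (Rmult_le_reg_l (r / 3)); lra.
have hd0 : d = 0%C.
  apply: Cmod_eq_0; apply: Rle_antisym; last exact: Cmod_ge_0.
  apply: Rnot_lt_le => hpos.
  have h4 : 0 < Cmod d / 6 by lra.
  have /= := key (mkposreal _ h4); lra.
have -> : l = (m + d)%C by rewrite /d; ring.
rewrite hd0; ring.
Qed.

Lemma alt_zeta_prod_eq (a : nat -> C -> C) (G : C -> C) (l : C) :
  is_alt_continuation a G -> @is_derive C_AbsRing C_NormedModule G (RtoC 0) l ->
  alt_zeta_prod a = Cexp (- l)%C.
Proof.
move=> hG hl; rewrite /alt_zeta_prod.
set P := fun w => _.
have [G' [[hs' [r hd']] ->]] : P (epsilon (inhabits (RtoC 0)) P).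
  by apply: epsilon_spec; exists (Cexp (- C_derive G (RtoC 0))%C), G.
congr (Cexp (- _)%C).
have h0 : @ex_derive C_AbsRing C_NormedModule G' (RtoC 0).
  by apply: hd'; right; rewrite Cmod_0; exact: cond_pos.
apply: derive_0_unique (C_derive_correct G' (RtoC 0) (RtoC 0) h0) hl => s hs.
have /is_series_C h1 := hs' s hs; have /is_series_C h2 := proj1 hG s hs.
exact: cvgC_unique h1 h2.
Qed.

(** * Shifted logarithms *)

Lemma log_like_zero : log_like 0 (fun _ => RtoC 0) 0.
Proof.
split => [|m|m|m|m]; rewrite /diff2.
- lra.
- have -> : (RtoC 0 - RtoC 0)%C = RtoC 0 by ring.
  rewrite Cmod_0 /Rdiv Rmult_0_l; lra.
- have -> : (RtoC 0 - RtoC 2 * RtoC 0 + RtoC 0)%C = RtoC 0 by ring.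
  rewrite Cmod_0 /Rdiv Rmult_0_l; lra.
- rewrite /=; lra.
- rewrite /= Rabs_R0; lra.
Qed.

Lemma log_like_plus (k1 k2 A1 A2 : R) (L1 L2 : nat -> C) :
  log_like k1 L1 A1 -> log_like k2 L2 A2 ->
  log_like (k1 + k2) (fun m => L1 m + L2 m)%C (A1 + A2).
Proof.
move=> [a1 b1 c1 d1 e1] [a2 b2 c2 d2 e2]; split => [|m|m|m|m].
- lra.
- have -> : (L1 (S m) + L2 (S m) - (L1 m + L2 m) = (L1 (S m) - L1 m) + (L2 (S m) - L2 m))%C by ring.
  apply: Rle_trans (Cmod_triangle _ _) _.
  have := b1 m; have := b2 m; rewrite /Rdiv Rmult_plus_distr_r; lra.
- have -> : diff2 (fun m => L1 m + L2 m)%C m = (diff2 L1 m + diff2 L2 m)%C by rewrite /diff2; ring.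
  apply: Rle_trans (Cmod_triangle _ _) _.
  have := c1 m; have := c2 m; rewrite /Rdiv Rmult_plus_distr_r; lra.
- have := d1 m; have := d2 m; rewrite /Re /=; lra.
- apply: Rle_trans (Rabs_triang _ _) _; have := e1 m; have := e2 m; rewrite /Im; lra.
Qed.

Lemma log_like_ext (k A : R) (L M : nat -> C) :
  (forall m, L m = M m) -> log_like k L A -> log_like k M A.
Proof. by move=> h [a b c d e]; split=> [|m|m|m|m]; rewrite /diff2 -?h //; exact: c. Qed.

Lemma bounded_of_eventually (f : nat -> R) (A : R) :
  (exists N, forall m, (N <= m)%coq_nat -> f m <= A) -> exists B, 0 <= B /\ forall m, f m <= B.
Proof.
case; move=> N; elim: N A => [|N IH] A h.
- exists (Rmax 0 A); split; first exact: Rmax_l.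
  by move=> m; apply: Rle_trans (h m _) (Rmax_r _ _); lia.
- apply: (IH (Rmax A (f N))) => m hm.
  case: (Nat.eq_dec m N) => [->|hne]; first exact: Rmax_r.
  by apply: Rle_trans (h m _) (Rmax_l _ _); lia.
Qed.

(** The second difference is a first difference of [f (t + 1) - f t], so the mean
value theorem applies twice. *)
Lemma differences_le_derivatives (f f1 f2 : R -> R) (y : R) :
  0 < y ->
  (forall t, 0 < t -> is_derive f t (f1 t)) ->
  (forall t, 0 < t -> is_derive f1 t (f2 t)) ->
  (forall t, 0 < t -> Rabs (f1 t) <= / t) ->
  (forall t, 0 < t -> Rabs (f2 t) <= / t ^ 2) ->
  Rabs (f (y + 1) - f y) <= / y /\ Rabs (f y - 2 * f (y + 1) + f (y + 1 + 1)) <= / y ^ 2.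
Proof.
move=> hy hf hf1 b1 b2; split.
- have [c [-> hc]] := MVT_cor2 f f1 y (y + 1) ltac:(lra)
    (fun c hc => proj1 (is_derive_Reals _ _ _) (hf c ltac:(lra))).
  have -> : f1 c * (y + 1 - y) = f1 c by ring.
  apply: Rle_trans (b1 c ltac:(lra)) _; apply: Rinv_le_contravar; lra.
- have hg c : y <= c <= y + 1 ->
    derivable_pt_lim (fun t => f (t + 1) - f t) c (f1 (c + 1) - f1 c).
    move=> hc; apply/is_derive_Reals; apply: (@is_derive_minus R_AbsRing R_NormedModule).
    + rewrite -[f1 (c + 1)]Rmult_1_l.
      apply: (is_derive_comp f (fun t => t + 1)); first by apply: hf; lra.
      by auto_derive => //; ring.
    + by apply: hf; lra.
  have [c [hc1 hc]] := MVT_cor2 (fun t => f (t + 1) - f t) (fun t => f1 (t + 1) - f1 t) y (y + 1) ltac:(lra) hg.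
  have -> : f y - 2 * f (y + 1) + f (y + 1 + 1) = f1 (c + 1) - f1 c.
    lra.
  have [e [-> he]] := MVT_cor2 f1 f2 c (c + 1) ltac:(lra)
    (fun e he => proj1 (is_derive_Reals _ _ _) (hf1 e ltac:(lra))).
  have -> : f2 e * (c + 1 - c) = f2 e by ring.
  apply: Rle_trans (b2 e ltac:(lra)) _; apply: Rinv_le_contravar; nra.
Qed.

Lemma Rabs_div_le (p q r : R) : 0 < q -> 0 < r -> Rabs p * r <= q -> Rabs (p / q) <= / r.
Proof.
move=> hq hr h; rewrite /Rdiv Rabs_mult (Rabs_pos_eq (/ q)); last by left; exact: Rinv_0_lt_compat.
apply: (Rmult_le_reg_r (q * r)); first nra.
have -> : Rabs p * / q * (q * r) = Rabs p * r by field; lra.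
have -> : / r * (q * r) = q by field; lra.
by [].
Qed.

Lemma Clog_diff_bounds (y b : R) : 0 < y ->
  Cmod (Clog ((y + 1)%R, b) - Clog (y, b))%C <= 2 / y /\
  Cmod (Clog (y, b) - RtoC 2 * Clog ((y + 1)%R, b) + Clog ((y + 1 + 1)%R, b))%C <= 2 / y ^ 2.
Proof.
move=> hy.
have pos t : 0 < t -> 0 < t ^ 2 + b ^ 2 by move=> ht; nra.
have [r1 r2] : Rabs (/ 2 * ln ((y + 1) ^ 2 + b ^ 2) - / 2 * ln (y ^ 2 + b ^ 2)) <= / y /\
  Rabs (/ 2 * ln (y ^ 2 + b ^ 2) - 2 * (/ 2 * ln ((y + 1) ^ 2 + b ^ 2)) +
    / 2 * ln ((y + 1 + 1) ^ 2 + b ^ 2)) <= / y ^ 2.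
  apply: (differences_le_derivatives (fun t => / 2 * ln (t ^ 2 + b ^ 2)) (fun t => t / (t ^ 2 + b ^ 2))
     (fun t => (b ^ 2 - t ^ 2) / (t ^ 2 + b ^ 2) ^ 2)) => // t ht; have hp := pos t ht.
  - auto_derive; [nra | field; lra].
  - auto_derive; [nra | field; lra].
  - apply: Rabs_div_le => //; rewrite Rabs_pos_eq; nra.
  - apply: Rabs_div_le; try nra.
    have : Rabs (b ^ 2 - t ^ 2) <= t ^ 2 + b ^ 2 by apply: Rabs_le; nra.
    have := Rabs_pos (b ^ 2 - t ^ 2); nra.
have [i1 i2] : Rabs (atan (b / (y + 1)) - atan (b / y)) <= / y /\
  Rabs (atan (b / y) - 2 * atan (b / (y + 1)) + atan (b / (y + 1 + 1))) <= / y ^ 2.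
  apply: (differences_le_derivatives (fun t => atan (b / t)) (fun t => (- b) / (t ^ 2 + b ^ 2))
     (fun t => (2 * b * t) / (t ^ 2 + b ^ 2) ^ 2)) => // t ht; have hp := pos t ht.
  - auto_derive; [lra | field; split; nra].
  - auto_derive; [nra | field; lra].
  - apply: Rabs_div_le => //; rewrite Rabs_Ropp.
    have := pow2_abs b; have := Rabs_pos b; nra.
  - apply: Rabs_div_le; try nra.
    have h : Rabs (2 * b * t) <= t ^ 2 + b ^ 2.
      by apply: Rabs_le; split; [have := pow2_ge_0 (t + b) | have := pow2_ge_0 (t - b)]; lra.
    apply: (Rle_trans _ ((t ^ 2 + b ^ 2) * t ^ 2)); first by apply: Rmult_le_compat_r; nra.
    nra.
rewrite !Clog_right; try lra.
split; (apply: Rle_trans (Cmod_le_sum _) _; rewrite /Rdiv).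
- move: r1 i1.
  set X := / 2 * ln (y ^ 2 + _); set X1 := / 2 * ln ((y + 1) ^ 2 + _).
  set Y := atan (b / y); set Y1 := atan (b / (y + 1)).
  have -> : Re ((X1, Y1) - (X, Y))%C = X1 - X by rewrite /Re /=; ring.
  have -> : Im ((X1, Y1) - (X, Y))%C = Y1 - Y by rewrite /Im /=; ring.
  lra.
- move: r2 i2.
  set X := / 2 * ln (y ^ 2 + _); set X1 := / 2 * ln ((y + 1) ^ 2 + _); set X2 := / 2 * ln ((y + 1 + 1) ^ 2 + _).
  set Y := atan (b / y); set Y1 := atan (b / (y + 1)); set Y2 := atan (b / (y + 1 + 1)).
  have -> : Re ((X, Y) - RtoC 2 * (X1, Y1) + (X2, Y2))%C = X - 2 * X1 + X2 by rewrite /Re /=; ring.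
  have -> : Im ((X, Y) - RtoC 2 * (X1, Y1) + (X2, Y2))%C = Y - 2 * Y1 + Y2 by rewrite /Im /=; ring.
  lra.
Qed.

Definition log_shift (x : C) (m : nat) : C := Clog (RtoC (INR m) + x)%C.

Lemma log_shift_pair (x : C) (m : nat) : log_shift x m = Clog ((INR m + Re x)%R, Im x).
Proof. by rewrite /log_shift; congr Clog; apply: C_eq; rewrite /Re /Im /=; ring. Qed.

Lemma eventually_half (a : R) :
  exists N, forall m, (N <= m)%coq_nat -> (INR m + 1) / 2 <= INR m + a.
Proof.
have [N hN] := nfloor_ex (Rabs (1 - 2 * a)) (Rabs_pos _).
exists (S N) => m hm.
have h1 : INR (S N) <= INR m by apply: le_INR.
rewrite S_INR in h1; have := Rle_abs (1 - 2 * a); lra.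
Qed.

(** The bounds come from calculus once [m + Re x] is large; before that the branch
cut may be crossed, but only finitely often. *)
Lemma log_like_log_shift (x : C) : exists A, log_like 1 (log_shift x) A.
Proof.
have [N hN] := eventually_half (Re x).
have hm0 m : 0 < INR m + 1 by have := pos_INR m; lra.
have hS m : (N <= m)%coq_nat -> 0 < INR m + Re x /\
   / (INR m + Re x) <= 2 / (INR m + 1) /\ / (INR m + Re x) ^ 2 <= 4 / (INR m + 1) ^ 2.
  move=> hm; have h := hN m hm; have h0 := hm0 m.
  split; [lra | split].
  - have -> : 2 / (INR m + 1) = / ((INR m + 1) / 2) by field; lra.
    apply: Rinv_le_contravar; lra.
  - have -> : 4 / (INR m + 1) ^ 2 = / ((INR m + 1) / 2) ^ 2 by field; lra.
    apply: Rinv_le_contravar; first nra.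
    by apply: pow_incr; lra.
have [B1 [p1 q1]] : exists B, 0 <= B /\ forall m, Cmod (log_shift x (S m) - log_shift x m)%C * (INR m + 1) <= B.
  apply: (bounded_of_eventually _ 4); exists N => m hm.
  have [hy [h1 _]] := hS m hm; have h0 := hm0 m.
  have [h2 _] := Clog_diff_bounds _ (Im x) hy.
  rewrite !log_shift_pair S_INR.
  have -> : INR m + 1 + Re x = INR m + Re x + 1 by ring.
  apply: Rle_trans (Rmult_le_compat_r _ _ _ (Rlt_le _ _ h0) h2) _.
  apply: (Rle_trans _ (2 * (2 / (INR m + 1)) * (INR m + 1))); last by right; field; lra.
  apply: Rmult_le_compat_r; rewrite /Rdiv in h1 *; lra.
have [B2 [p2 q2]] : exists B, 0 <= B /\ forall m, Cmod (diff2 (log_shift x) m) * (INR m + 1) ^ 2 <= B.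
  apply: (bounded_of_eventually _ 8); exists N => m hm.
  have [hy [_ h1]] := hS m hm; have h0 := hm0 m.
  have [_ h2] := Clog_diff_bounds _ (Im x) hy.
  rewrite /diff2 !log_shift_pair !S_INR.
  have -> : INR m + 1 + 1 + Re x = INR m + Re x + 1 + 1 by ring.
  have -> : INR m + 1 + Re x = INR m + Re x + 1 by ring.
  have hp : 0 <= (INR m + 1) ^ 2 by nra.
  apply: Rle_trans (Rmult_le_compat_r _ _ _ hp h2) _.
  apply: (Rle_trans _ (2 * (4 / (INR m + 1) ^ 2) * (INR m + 1) ^ 2)); last by right; field; lra.
  apply: Rmult_le_compat_r; rewrite /Rdiv in h1 *; lra.
have [B3 [p3 q3]] : exists B, 0 <= B /\ forall m, ln (INR m + 1) - Re (log_shift x m) <= B.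
  apply: (bounded_of_eventually _ (ln 2)); exists N => m hm.
  have [hy _] := hS m hm; have h0 := hm0 m; have h := hN m hm.
  rewrite log_shift_pair Clog_right // /Re /= -/(Re x) !Rmult_1_r.
  have : ln ((INR m + 1) / 2 * ((INR m + 1) / 2)) <= ln ((INR m + Re x) * (INR m + Re x) + Im x * Im x).
    apply: ln_le; nra.
  rewrite ln_mult; try lra; rewrite ln_div; try lra.
exists (B1 + B2 + B3 + PI); have hpi := PI_RGT_0; split=> [|m|m|m|m].
- lra.
- have h0 := hm0 m; apply: (Rmult_le_reg_r (INR m + 1)) => //.
  have -> : (B1 + B2 + B3 + PI) / (INR m + 1) * (INR m + 1) = B1 + B2 + B3 + PI by field; lra.
  have := q1 m; lra.
- have h0 := hm0 m; apply: (Rmult_le_reg_r ((INR m + 1) ^ 2)); first nra.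
  have -> : (B1 + B2 + B3 + PI) / (INR m + 1) ^ 2 * (INR m + 1) ^ 2 = B1 + B2 + B3 + PI by field; lra.
  have := q2 m; lra.
- have := q3 m; lra.
- have := Rabs_Im_Clog (RtoC (INR m) + x)%C; rewrite -/(log_shift x m); lra.
Qed.

Lemma is_lim_seq_inv_succ : is_lim_seq (fun m => / (INR m + 1)) 0.
Proof.
have h : is_lim_seq (fun m => INR m + 1) p_infty.
  have h := proj1 (is_lim_seq_incr_1 _ _) is_lim_seq_INR.
  by apply: is_lim_seq_ext h => m; rewrite S_INR.
by apply: (is_lim_seq_inv _ _ h).
Qed.

Lemma log_shift_ln (x : C) : cvgC (fun m => log_shift x m - RtoC (ln (INR m + 1)))%C 0%C.
Proof.
have [N hN] := eventually_half (Re x).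
have hm0 m : 0 < INR m + 1 by have := pos_INR m; lra.
have hq : is_lim_seq (fun m => (INR m + Re x) / (INR m + 1)) 1.
  apply: (is_lim_seq_ext (fun m => 1 + (Re x - 1) * / (INR m + 1))).
    by move=> m; have := hm0 m => h; field; lra.
  apply: (is_lim_seq_val _ (1 + (Re x - 1) * 0)); first ring.
  apply: is_lim_seq_plus'; first exact: is_lim_seq_const.
  by apply: is_lim_seq_mult'; [exact: is_lim_seq_const | exact: is_lim_seq_inv_succ].
have hb : is_lim_seq (fun m => Im x * / (INR m + 1)) 0.
  apply: (is_lim_seq_val _ (Im x * 0)); first ring.
  by apply: is_lim_seq_mult'; [exact: is_lim_seq_const | exact: is_lim_seq_inv_succ].
have hre : is_lim_seq (fun m => / 2 * ln (((INR m + Re x) / (INR m + 1)) * ((INR m + Re x) / (INR m + 1)) +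
    (Im x * / (INR m + 1)) * (Im x * / (INR m + 1)))) 0.
  apply: (is_lim_seq_val _ (/ 2 * ln (1 * 1 + 0 * 0))).
    by rewrite !Rmult_1_l Rmult_0_l Rplus_0_r ln_1; ring.
  apply: is_lim_seq_mult'; first exact: is_lim_seq_const.
  apply: is_lim_seq_continuous.
    apply: derivable_continuous_pt; exists (/ (1 * 1 + 0 * 0)); apply: derivable_pt_lim_ln; lra.
  by apply: is_lim_seq_plus'; apply: is_lim_seq_mult'.
have him : is_lim_seq (fun m => atan ((Im x * / (INR m + 1)) * / ((INR m + Re x) / (INR m + 1)))) 0.
  apply: (is_lim_seq_val _ (atan (0 * / 1))); first by rewrite Rmult_0_l atan_0.
  apply: is_lim_seq_continuous.
    by apply: derivable_continuous_pt; exact: derivable_pt_atan.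
  apply: is_lim_seq_mult' => //.
  by apply: (is_lim_seq_inv _ 1) => //; case=> h; lra.
have hre' := is_lim_seq_abs _ _ hre; have him' := is_lim_seq_abs _ _ him.
rewrite /= Rabs_R0 in hre' him'.
have hs := is_lim_seq_plus' _ _ _ _ hre' him'; rewrite Rplus_0_r in hs.
apply: (is_lim_seq_le_le_loc (fun _ => 0) _ _ _ _ (is_lim_seq_const 0) hs).
exists N => m hm; split; first exact: Cmod_ge_0.
apply: Rle_trans (Cmod_le_sum _) _; right.
have h := hN m hm; have h0 := hm0 m.
have -> : (log_shift x m - RtoC (ln (INR m + 1)) - 0 = log_shift x m - RtoC (ln (INR m + 1)))%C by ring.
rewrite log_shift_pair Clog_right; last lra.
congr (Rabs _ + Rabs _).
- rewrite /Re /= -/(Re x).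
  have -> : (INR m + Re x) / (INR m + 1) * ((INR m + Re x) / (INR m + 1)) +
     Im x * / (INR m + 1) * (Im x * / (INR m + 1)) =
     ((INR m + Re x) * ((INR m + Re x) * 1) + Im x * (Im x * 1)) / ((INR m + 1) * (INR m + 1)) by field; lra.
  rewrite ln_div; [|nra|nra].
  rewrite (ln_mult (INR m + 1)) //; field.
- rewrite /Im /= -/(Re x) -/(Im x) Ropp_0 Rplus_0_r; congr atan; field; lra.
Qed.

(** * Wallis's product and the alternating harmonic series *)

Fixpoint wallis (M : nat) : R :=
  if M is S p then wallis p * ((2 * INR p + 2) / (2 * INR p + 1)) else 1.

Definition sin_integral (n : nat) : R := RInt (fun t => sin t ^ n) 0 (PI / 2).

Lemma ex_sin_integral (n : nat) : ex_RInt (fun t => sin t ^ n) 0 (PI / 2).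
Proof.
apply: (@ex_RInt_continuous R_CompleteNormedModule) => t _.
apply: (@ex_derive_continuous R_AbsRing R_NormedModule); by auto_derive.
Qed.

(** Integration by parts, in the form of the primitive [- cos t (sin t)^(n+1)],
which vanishes at both ends. *)
Lemma sin_integral_rec (n : nat) :
  (INR n + 2) * sin_integral (S (S n)) = (INR n + 1) * sin_integral n.
Proof.
pose F := fun t => - cos t * sin t ^ (S n).
have hF : is_RInt (fun t => (INR n + 2) * sin t ^ (S (S n)) - (INR n + 1) * sin t ^ n) 0 (PI / 2)
   (F (PI / 2) - F 0).
  apply: (is_RInt_derive F) => t _.
  - rewrite /F; auto_derive => //.
    have := sin2_cos2 t; rewrite /Rsqr => h.
    have hc : cos t * cos t = 1 - sin t * sin t by lra.
    rewrite -[match n with O => 1 | S _ => INR n + 1 end]/(INR (S n)) S_INR /=.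
    transitivity (sin t * (sin t * sin t ^ n) - (INR n + 1) * sin t ^ n * (cos t * cos t)); first ring.
    rewrite hc; ring.
  - apply: (@ex_derive_continuous R_AbsRing R_NormedModule); by auto_derive.
have e : F (PI / 2) - F 0 = 0 by rewrite /F cos_PI2 sin_0 /=; ring.
rewrite e in hF.
have h1 := is_RInt_scal _ _ _ (INR n + 2) _ (RInt_correct _ _ _ (ex_sin_integral (S (S n)))).
have h2 := is_RInt_scal _ _ _ (INR n + 1) _ (RInt_correct _ _ _ (ex_sin_integral n)).
have h3 := is_RInt_minus _ _ _ _ _ _ h1 h2.
have := is_RInt_unique _ _ _ _ h3; have := is_RInt_unique _ _ _ _ hF => h4.
rewrite -[RInt _ _ _ in X in X -> _]/(RInt (fun t => (INR n + 2) * sin t ^ (S (S n)) - (INR n + 1) * sin t ^ n) 0 (PI / 2)).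
rewrite h4 /sin_integral /minus /plus /opp /scal /= /mult /=; lra.
Qed.

Lemma sin_integral_decr (n : nat) : sin_integral (S n) <= sin_integral n.
Proof.
have hpi := PI_RGT_0.
apply: RInt_le; [lra | exact: ex_sin_integral | exact: ex_sin_integral |].
move=> t ht; rewrite /=; have [_ h1] := SIN_bound t.
have h0 : 0 <= sin t by apply: sin_ge_0; lra.
have := pow_le _ n h0; nra.
Qed.

Lemma wallis_pos (M : nat) : 0 < wallis M.
Proof.
elim: M => [|M IH] /=; first lra.
by apply: Rmult_lt_0_compat => //; apply: Rdiv_lt_0_compat; have := pos_INR M; lra.
Qed.

Lemma sin_integral_even_odd (M : nat) :
  sin_integral (2 * M)%coq_nat * wallis M = PI / 2 /\
  (2 * INR M + 1) * sin_integral (S (2 * M)%coq_nat) = wallis M.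
Proof.
elim: M => [|M [IH1 IH2]].
- rewrite [(2 * 0)%coq_nat]/= /sin_integral; split.
  + rewrite (RInt_ext _ (fun _ => 1)) // RInt_const /scal /= /mult /=; lra.
  + rewrite (RInt_ext _ (fun t => sin t)); last by move=> t _; rewrite /= Rmult_1_r.
    have h : is_RInt sin 0 (PI / 2) (- cos (PI / 2) - - cos 0).
      apply: (is_RInt_derive (fun t => - cos t)) => t _; first by auto_derive => //; ring.
      by apply: (@ex_derive_continuous R_AbsRing R_NormedModule); auto_derive.
    rewrite (is_RInt_unique _ _ _ _ h) cos_PI2 cos_0 /=; ring.
- have -> : (2 * S M)%coq_nat = S (S (2 * M)%coq_nat) by lia.
  have hM := pos_INR M.
  have h1 := sin_integral_rec (2 * M)%coq_nat; have h2 := sin_integral_rec (S (2 * M)%coq_nat).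
  have e : INR (2 * M)%coq_nat = 2 * INR M by rewrite mult_INR.
  rewrite S_INR e in h2; rewrite e in h1.
  rewrite [wallis (S M)]/= S_INR; split.
  + rewrite -IH1; field_simplify_eq; last lra.
    transitivity (((2 * INR M + 2) * sin_integral (S (S (2 * M)%coq_nat))) * wallis M); first ring.
    rewrite h1; ring.
  + rewrite -IH2.
    transitivity ((2 * INR M + 1 + 2) * sin_integral (S (S (S (2 * M)%coq_nat)))); first by congr (_ * _); ring.
    rewrite h2; field; lra.
Qed.

(** Three consecutive integrals of powers of the sine are in decreasing order;
the first and the third have a ratio tending to 1. *)
Lemma wallis_limit : is_lim_seq (fun M => wallis M / sqrt (2 * INR M + 1)) (sqrt (PI / 2)).
Proof.
have hpi := PI_RGT_0.
have hsq : is_lim_seq (fun M => wallis M ^ 2 / (2 * INR M + 1)) (PI / 2).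
  apply: (is_lim_seq_le_le (fun M => PI / 2 * (1 - / 2 * / (INR M + 1))) _ (fun _ => PI / 2)).
  - move=> M; have [h1 h2] := sin_integral_even_odd M; have hM := pos_INR M.
    have h3 := sin_integral_decr (2 * M)%coq_nat; have h4 := sin_integral_decr (S (2 * M)%coq_nat).
    have h5 := sin_integral_rec (2 * M)%coq_nat; rewrite mult_INR /= in h5.
    have hw := wallis_pos M.
    have -> : wallis M ^ 2 / (2 * INR M + 1) = wallis M * sin_integral (S (2 * M)%coq_nat).
      transitivity (wallis M * ((2 * INR M + 1) * sin_integral (S (2 * M)%coq_nat)) / (2 * INR M + 1)).
        by rewrite h2; field; lra.
      field; lra.
    split.
    + rewrite -h1.
      have e : sin_integral (2 * M)%coq_nat * (1 - / 2 * / (INR M + 1)) = sin_integral (S (S (2 * M)%coq_nat)).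
        apply: (Rmult_eq_reg_l (2 * INR M + 2)); last lra.
        transitivity ((2 * INR M + 1) * sin_integral (2 * M)%coq_nat); first by field; lra.
        rewrite /= in h5 *; lra.
      have -> : sin_integral (2 * M)%coq_nat * wallis M * (1 - / 2 * / (INR M + 1)) =
        wallis M * (sin_integral (2 * M)%coq_nat * (1 - / 2 * / (INR M + 1))) by ring.
      rewrite e; apply: Rmult_le_compat_l; lra.
    + rewrite -h1 Rmult_comm; apply: Rmult_le_compat_r; lra.
  - apply: (is_lim_seq_val _ (PI / 2 * (1 - / 2 * 0))); first field.
    apply: is_lim_seq_mult'; first exact: is_lim_seq_const.
    apply: is_lim_seq_minus'; first exact: is_lim_seq_const.
    apply: is_lim_seq_mult'; [exact: is_lim_seq_const | exact: is_lim_seq_inv_succ].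
  - exact: is_lim_seq_const.
apply: (is_lim_seq_ext (fun M => sqrt (wallis M ^ 2 / (2 * INR M + 1)))).
  move=> M; have hM := pos_INR M; have hw := wallis_pos M.
  rewrite sqrt_div; [|nra|lra].
  by rewrite sqrt_pow2; lra.
apply: is_lim_seq_continuous hsq.
by apply: continuity_pt_sqrt; lra.
Qed.

Fixpoint harmonic (N : nat) : R := if N is S p then harmonic p + / (INR p + 1) else 0.

(** Both differences of logarithms are sums of the corresponding differences
[ln (k + 1) - ln k], which lie between [1 / (k + 1)] and [1 / k]. *)
Lemma harmonic_bounds (M k : nat) :
  ln (INR (M + k)%coq_nat + 1) - ln (INR M + 1) <= harmonic (M + k)%coq_nat - harmonic M /\
  (0 < INR M -> harmonic (M + k)%coq_nat - harmonic M <= ln (INR (M + k)%coq_nat) - ln (INR M)).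
Proof.
elim: k => [|k [IH1 IH2]]; first by rewrite Nat.add_0_r; split=> [|_]; lra.
rewrite Nat.add_succ_r [harmonic (S _)]/= S_INR.
have h := pos_INR (M + k)%coq_nat.
split=> [|hM].
- have [_ h1] := ln_step (INR (M + k)%coq_nat + 1) ltac:(lra); lra.
- have hMk : 0 < INR (M + k)%coq_nat by rewrite plus_INR; have := pos_INR k; lra.
  have [h1 _] := ln_step _ hMk; have := IH2 hM; lra.
Qed.

(** The alternating harmonic sum of length [2M] is the sum of [1/k] for
[M < k <= 2M]. *)
Lemma alternating_harmonic_limit :
  is_lim_seq (fun M => harmonic (2 * M)%coq_nat - harmonic M) (ln 2).
Proof.
apply: (is_lim_seq_le_le_loc (fun M => ln (2 - / (INR M + 1))) _ (fun _ => ln 2)).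
- exists 1%nat => M hM.
  have hM1 : 1 <= INR M by apply: (le_INR 1).
  have [h1 h2] := harmonic_bounds M M; have {}h2 := h2 ltac:(lra).
  have -> : (2 * M)%coq_nat = (M + M)%coq_nat by lia.
  rewrite plus_INR in h1 h2.
  have -> : 2 - / (INR M + 1) = (INR M + INR M + 1) / (INR M + 1) by field; lra.
  rewrite ln_div; try lra.
  split=> //; move: h2.
  have -> : INR M + INR M = 2 * INR M by ring.
  rewrite ln_mult; lra.
- have h : is_lim_seq (fun M => 2 - / (INR M + 1)) 2.
    apply: (is_lim_seq_val _ (2 - 0)); first ring.
    by apply: is_lim_seq_minus'; [exact: is_lim_seq_const | exact: is_lim_seq_inv_succ].
  apply: is_lim_seq_continuous h.
  by apply: derivable_continuous_pt; exists (/ 2); apply: derivable_pt_lim_ln; lra.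
- exact: is_lim_seq_const.
Qed.

(** * The modified gamma function *)

HB.instance Definition _ := Monoid.isComLaw.Build C (RtoC 1) Cmult Cmult_assoc Cmult_comm Cmult_1_l.
HB.instance Definition _ := Monoid.isComLaw.Build C (RtoC 0) Cplus Cplus_assoc Cplus_comm Cplus_0_l.

Lemma odd_double (M : nat) : odd (2 * M)%coq_nat = false.
Proof.
elim: M => // M IH; have -> : (2 * S M)%coq_nat = S (S (2 * M)%coq_nat) by lia.
by rewrite /= negbK.
Qed.

Lemma mgamma_partial_S (x : C) (N : nat) :
  mgamma_partial x (S N) = (mgamma_partial x N * mgamma_factor x (S N))%C.
Proof. by rewrite /mgamma_partial big_nat_recr. Qed.

Lemma shift_neq_0 (x : C) (hx : forall k : nat, x <> (- RtoC (INR k))%C) (m : nat) : (RtoC (INR m) + x)%C <> 0%C.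
Proof.
move=> h; apply: (hx m); have -> : x = (RtoC (INR m) + x - RtoC (INR m))%C by ring.
rewrite h; ring.
Qed.

Lemma Cexp_log_shift (x : C) (hx : forall k : nat, x <> (- RtoC (INR k))%C) (m : nat) : Cexp (log_shift x m) = (RtoC (INR m) + x)%C.
Proof. by apply: Cexp_Clog; exact: (shift_neq_0 x hx). Qed.

(** At even indices the convergence factors collect into a partial sum of the
alternating harmonic series, the denominators [m] into Wallis's product, and the
factors [m + x] into the exponential of an alternating sum of logarithms. *)
Lemma mgamma_partial_even (x : C) (hx : forall k : nat, x <> (- RtoC (INR k))%C) (M : nat) :
  mgamma_partial x (2 * M)%coq_nat =
  (x * Cexp (- (x * RtoC (harmonic (2 * M)%coq_nat - harmonic M))) * RtoC (wallis M) *
    Cexp (- altsum (log_shift x) (2 * M)%coq_nat))%C.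
Proof.
elim: M => [|M IH].
  rewrite /mgamma_partial big_nil /altsum sum_O /=.
  have -> : (- (x * RtoC (0 - 0)) = 0)%C by rewrite Rminus_0_r; ring.
  have -> : (- (1 * log_shift x 0) = - log_shift x 0)%C by ring.
  rewrite Cexp_opp (Cexp_log_shift x hx) Cexp_0 /=.
  have h0 : x <> 0%C by have := shift_neq_0 x hx 0; rewrite /= Cplus_0_l.
  rewrite Cplus_0_l; field; exact: h0.
have e2 : (2 * S M)%coq_nat = S (S (2 * M)%coq_nat) by lia.
rewrite e2 !mgamma_partial_S IH !altsum_S.
set N := (2 * M)%coq_nat.
have eN : INR N = 2 * INR M by rewrite /N mult_INR.
have hM := pos_INR M.
have -> : (RtoC (-1) ^ S (S N))%C = RtoC 1.
  by rewrite /N -e2 sign_even.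
have -> : (RtoC (-1) ^ S N)%C = (- RtoC 1)%C.
  rewrite Cpow_S /N sign_even Cmult_1_r -RtoC_opp; congr RtoC; ring.
set p := 2 * INR M + 1; set q := 2 * INR M + 2.
have hp : RtoC p <> RtoC 0 by move/RtoC_inj; rewrite /p; lra.
have hq : RtoC q <> RtoC 0 by move/RtoC_inj; rewrite /q; lra.
have hp' : p <> 0 by rewrite /p; lra.
have hq' : q <> 0 by rewrite /q; lra.
have ep : INR (S N) = p by rewrite S_INR eN.
have eq : INR (S (S N)) = q by rewrite S_INR ep /p /q; ring.
have -> : mgamma_factor x (S N) = (Cexp (- (x / RtoC p)) * (RtoC 1 + x / RtoC p))%C.
  by rewrite /mgamma_factor ep oddS /N odd_double.
have -> : mgamma_factor x (S (S N)) = (/ (Cexp (- (x / RtoC q)) * (RtoC 1 + x / RtoC q)))%C.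
  by rewrite /mgamma_factor eq !oddS /N odd_double.
have -> : harmonic (S (S N)) - harmonic (S M) = harmonic N - harmonic M + (/ p - / q).
  change (harmonic N + / (INR N + 1) + / (INR (S N) + 1) - (harmonic M + / (INR M + 1)) =
    harmonic N - harmonic M + (/ p - / q)).
  rewrite S_INR eN /p /q; field; lra.
have -> : wallis (S M) = wallis M * (q / p) by [].
have -> : Cexp (- (x * RtoC (harmonic N - harmonic M + (/ p - / q))))%C =
  (Cexp (- (x * RtoC (harmonic N - harmonic M))) * Cexp (- (x / RtoC p)) * / Cexp (- (x / RtoC q)))%C.
  rewrite -Cexp_opp -!Cexp_plus; congr Cexp.
  rewrite RtoC_plus (RtoC_minus (/ p)) !RtoC_inv /Cdiv //; ring.
have -> : Cexp (- (altsum (log_shift x) N + - RtoC 1 * log_shift x (S N) + RtoC 1 * log_shift x (S (S N))))%C =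
  (Cexp (- altsum (log_shift x) N) * (RtoC p + x) * / (RtoC q + x))%C.
  rewrite -ep -eq -!(Cexp_log_shift x hx) -Cexp_opp -!Cexp_plus; congr Cexp; ring.
have h1 := Cexp_neq_0 (- (x / RtoC p))%C; have h2 := Cexp_neq_0 (- (x / RtoC q))%C.
have h3 := shift_neq_0 x hx (S (S N)); rewrite eq in h3.
rewrite RtoC_mult RtoC_div //.
field; repeat split => //.
Qed.

(** The tail correction at an even index is half a logarithm up to [o(1)]; it
turns into the normalization [sqrt (2M + 1)] of Wallis's product. *)
Lemma alttail_log_shift (x : C) :
  cvgC (fun M => alttail (log_shift x) (2 * M)%coq_nat - RtoC (/ 2 * ln (2 * INR M + 1)))%C 0%C.
Proof.
pose r m := (log_shift x m - RtoC (ln (INR m + 1)))%C.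
pose e N := / 2 * (ln (INR N + 1 + 1) - ln (INR N + 1)) - / 4 * (ln (INR N + 1 + 1 + 1) - ln (INR N + 1 + 1)).
have hr := log_shift_ln x.
have h1 : cvgC (fun N => r (S N)) 0%C by apply: (cvgC_sub r) hr; apply: eventually_subseq => n; lia.
have h2 : cvgC (fun N => r (S (S N))) 0%C by apply: (cvgC_sub r) hr; apply: eventually_subseq => n; lia.
have he : is_lim_seq e 0.
  apply: (is_lim_seq_le_le (fun N => - / (INR N + 1)) _ (fun N => / (INR N + 1))).
  - move=> N; have hN := pos_INR N.
    have [a1 a2] := ln_step (INR N + 1) ltac:(lra); have [b1 b2] := ln_step (INR N + 1 + 1) ltac:(lra).
    have c1 : 0 < / (INR N + 1 + 1) by apply: Rinv_0_lt_compat; lra.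
    have c2 : 0 < / (INR N + 1 + 1 + 1) by apply: Rinv_0_lt_compat; lra.
    have c3 : / (INR N + 1 + 1) <= / (INR N + 1) by apply: Rinv_le_contravar; lra.
    rewrite /e; lra.
  - apply: (is_lim_seq_val _ (- 0)); first ring.
    exact: (proj1 (is_lim_seq_opp _ 0) is_lim_seq_inv_succ).
  - exact: is_lim_seq_inv_succ.
have h3 := cvgC_plus _ _ _ _ (cvgC_plus _ _ _ _ (cvgC_mult _ _ _ _ (cvgC_const (RtoC 3 / RtoC 4)%C) h1)
  (cvgC_mult _ _ _ _ (cvgC_const (- / RtoC 4)%C) h2)) (cvgC_RtoC _ _ he).
have h4 : cvgC (fun N => (RtoC 3 * log_shift x (S N) - log_shift x (S (S N))) / RtoC 4 - RtoC (/ 2 * ln (INR N + 1)))%C 0%C.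
  have e0 : (RtoC 3 / RtoC 4 * 0 + - / RtoC 4 * 0 + 0 = 0)%C by ring.
  rewrite e0 in h3; apply: cvgC_ext h3 => N.
  have -> : RtoC (e N) = (RtoC 3 / RtoC 4 * RtoC (ln (INR N + 1 + 1)) - / RtoC 4 * RtoC (ln (INR N + 1 + 1 + 1)) - RtoC (/ 2 * ln (INR N + 1)))%C.
    have -> : e N = 3 * / 4 * ln (INR N + 1 + 1) - / 4 * ln (INR N + 1 + 1 + 1) - / 2 * ln (INR N + 1) by rewrite /e; field.
    rewrite !RtoC_minus (RtoC_mult (3 * / 4)) (RtoC_mult 3) (RtoC_mult (/ 4)) RtoC_inv; last lra.
    rewrite /Cdiv; ring.
  rewrite /r !S_INR; field; exact: RtoC4_neq_0.
have hsub : filterlim (fun M => (2 * M)%coq_nat) eventually eventually.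
  by apply: eventually_subseq => n; lia.
apply: cvgC_ext (cvgC_sub _ _ _ hsub h4) => M.
by rewrite /alttail sign_even Cmult_1_l mult_INR.
Qed.

Lemma mgamma_factor_cvg1 (x : C) : cvgC (fun M => mgamma_factor x (S (2 * M)%coq_nat)) (RtoC 1).
Proof.
have hinv : cvgC (fun M => x * RtoC (/ (INR (2 * M)%coq_nat + 1)))%C 0%C.
  have hsub : filterlim (fun M => (2 * M)%coq_nat) eventually eventually.
    by apply: eventually_subseq => n; lia.
  have := cvgC_mult _ _ _ _ (cvgC_const x) (cvgC_sub _ _ _ hsub (cvgC_RtoC _ _ is_lim_seq_inv_succ)).
  by rewrite Cmult_0_r.
have := cvgC_mult _ _ _ _ (cvgC_Cexp _ _ (cvgC_opp _ _ hinv)) (cvgC_plus _ _ _ _ (cvgC_const (RtoC 1)) hinv).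
have -> : (Cexp (- 0) * (1 + 0) = 1)%C.
  have -> : (- 0 = 0)%C by ring.
  rewrite Cexp_0; ring.
apply: cvgC_ext => M; rewrite /mgamma_factor oddS odd_double [~~ false]/= S_INR.
have h := pos_INR (2 * M)%coq_nat.
by rewrite RtoC_inv //; lra.
Qed.

(** The odd partial products follow the even ones because the factors tend to 1. *)
Lemma mgamma_partial_cvg (x : C) (hx : forall k : nat, x <> (- RtoC (INR k))%C) (z : C) :
  cvgC (regsum (log_shift x)) z ->
  cvgC (mgamma_partial x)
    (x * Cexp (- (x * RtoC (ln 2))) * RtoC (sqrt (PI / 2)) * Cexp (- z))%C.
Proof.
move=> hz.
have hsub : filterlim (fun M => (2 * M)%coq_nat) eventually eventually.
  by apply: eventually_subseq => n; lia.
have hz2 := cvgC_plus _ _ _ _ (cvgC_sub _ _ _ hsub hz) (alttail_log_shift x).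
have -> : z = (z + 0)%C by ring.
have h1 := cvgC_mult _ _ _ _ (cvgC_const x)
   (cvgC_Cexp _ _ (cvgC_opp _ _ (cvgC_mult _ _ _ _ (cvgC_const x) (cvgC_RtoC _ _ alternating_harmonic_limit)))).
have h2 := cvgC_mult _ _ _ _ h1 (cvgC_RtoC _ _ wallis_limit).
have h3 := cvgC_mult _ _ _ _ h2 (cvgC_Cexp _ _ (cvgC_opp _ _ hz2)).
have heven : cvgC (fun M => mgamma_partial x (2 * M)%coq_nat)
    (x * Cexp (- (x * RtoC (ln 2))) * RtoC (sqrt (PI / 2)) * Cexp (- (z + 0)))%C.
  apply: cvgC_ext h3 => M; rewrite (mgamma_partial_even x hx) -!Cmult_assoc; congr (_ * (_ * _))%C.
  have hM := pos_INR M.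
  have hs : 0 < sqrt (2 * INR M + 1) by apply: sqrt_lt_R0; lra.
  rewrite /regsum.
  set S := altsum _ _; set T := alttail _ _.
  have -> : (- S)%C = (- (S - T + (T - RtoC (/ 2 * ln (2 * INR M + 1)))) + - RtoC (/ 2 * ln (2 * INR M + 1)))%C by ring.
  rewrite Cexp_plus (Cexp_opp (RtoC _)) Cexp_real exp_half_ln; last lra.
  rewrite RtoC_div; last lra.
  by rewrite /Cdiv; ring.
apply: cvgC_even_odd => //.
have := cvgC_mult _ _ _ _ heven (mgamma_factor_cvg1 x).
rewrite Cmult_1_r; apply: cvgC_ext => M.
by rewrite mgamma_partial_S.
Qed.

Lemma mgamma_of_regsum (x : C) (hx : forall k : nat, x <> (- RtoC (INR k))%C) (z : C) :
  cvgC (regsum (log_shift x)) z ->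
  mgamma_prod_converges x /\ mgamma x = (RtoC (sqrt (PI / 2)) * Cexp (- z))%C.
Proof.
move=> /(mgamma_partial_cvg x hx); set l := (_ * _)%C => hl.
have hx0 : x <> 0%C by have := shift_neq_0 x hx 0; rewrite /= Cplus_0_l.
have hpi := PI_RGT_0.
split.
- exists l; split; last by apply/cvgC_filterlim.
  have hs : RtoC (sqrt (PI / 2)) <> RtoC 0.
    by move/RtoC_inj; have := sqrt_lt_R0 (PI / 2) ltac:(lra); lra.
  rewrite /l; apply: Cmult_neq_0; last exact: Cexp_neq_0.
  apply: Cmult_neq_0 => //; apply: Cmult_neq_0 => //; exact: Cexp_neq_0.
- have [h1 h2] := cvgC_Re_Im _ _ hl.
  rewrite /mgamma (is_lim_seq_unique _ _ h1) (is_lim_seq_unique _ _ h2).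
  have -> : (real (Re l), real (Im l)) = l by clearbody l; case: l hl h1 h2.
  rewrite /l Cexp_opp; field; split => //; exact: Cexp_neq_0.
Qed.

(** * The zeta-regularized products *)

Lemma is_alt_continuation_ext (a b : nat -> C -> C) (G : C -> C) :
  (forall m s, a m s = b m s) -> is_alt_continuation a G -> is_alt_continuation b G.
Proof.
move=> h [h1 h2]; split=> // s hs.
by apply: is_series_ext (h1 s hs) => m; rewrite h.
Qed.

(** The regularized product is the exponential of the averaged alternating sum of
the logarithms; everything about it is then read off from [regsum]. *)
Lemma alt_zeta_prod_exp_terms (k A : R) (L : nat -> C) (a : nat -> C -> C) :
  0 < k -> log_like k L A -> (forall m s, a m s = exp_terms L s m) ->
  has_alt_continuation a /\
  exists z, cvgC (regsum L) z /\ alt_zeta_prod a = Cexp z.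
Proof.
move=> hk hL ha.
have [G [l [hG [hd hl]]]] := exp_terms_continuation _ _ _ hk hL.
have {}hG : is_alt_continuation a G by apply: is_alt_continuation_ext hG => m s.
split; first by exists G.
exists (- l)%C; split; last exact: alt_zeta_prod_eq hG hd.
by apply: cvgC_ext (cvgC_opp _ _ hl) => N; rewrite regsum_opp; ring.
Qed.

Lemma single_power_exp_terms (y : C) (m : nat) (s : C) :
  single_power y m s = exp_terms (log_shift y) s m.
Proof. by rewrite /single_power /Cpower /exp_terms; congr Cexp; rewrite /log_shift; ring. Qed.

Lemma multi_power_exp_terms (n : nat) (x : 'I_n -> C) (m : nat) (s : C) :
  multi_power n x m s =
  exp_terms (fun i => \big[Cplus/RtoC 0]_(j < n) log_shift (x j) i) s m.
Proof.
have -> : exp_terms (fun i => \big[Cplus/RtoC 0]_(j < n) log_shift (x j) i) s m =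
  (fun w => Cexp (- s * w)%C) (\big[Cplus/RtoC 0]_(j < n) log_shift (x j) m).
  by rewrite /exp_terms; congr Cexp; ring.
rewrite (big_morph (fun w => Cexp (- s * w)%C) (id1 := RtoC 1) (op1 := Cmult)) //.
- by move=> u v; rewrite -Cexp_plus; congr Cexp; ring.
- by rewrite Cmult_0_r Cexp_0.
Qed.

Lemma log_like_sum (I : Type) (r : seq I) (L : I -> nat -> C) :
  (forall i, exists A, log_like 1 (L i) A) ->
  exists A, log_like (INR (size r)) (fun m => \big[Cplus/RtoC 0]_(i <- r) L i m) A.
Proof.
move=> hL; elim: r => [|i r [A IH]].
  by exists 0; apply: log_like_ext log_like_zero => m; rewrite big_nil.
have [B hB] := hL i; exists (B + A); rewrite [size _]/= S_INR Rplus_comm.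
by apply: log_like_ext (log_like_plus _ _ _ _ _ _ hB IH) => m; rewrite big_cons.
Qed.

Lemma regsum_sum (I : Type) (r : seq I) (L : I -> nat -> C) (z : I -> C) :
  (forall i, cvgC (regsum (L i)) (z i)) ->
  cvgC (regsum (fun m => \big[Cplus/RtoC 0]_(i <- r) L i m)) (\big[Cplus/RtoC 0]_(i <- r) z i).
Proof.
have regsum_ext u v N : (forall m, u m = v m) -> regsum u N = regsum v N.
  move=> h; rewrite /regsum /alttail !h; congr (_ - _)%C.
  by apply: sum_n_ext => m; rewrite h.
move=> hL; elim: r => [|i r IH].
  rewrite big_nil; apply: cvgC_ext (cvgC_const _) => N.
  by rewrite (regsum_ext _ (fun _ => RtoC 0) N) ?regsum_zero // => m; rewrite big_nil.
rewrite big_cons; apply: cvgC_ext (cvgC_plus _ _ _ _ (hL i) IH) => N.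
by rewrite -regsum_plus; apply: regsum_ext => m; rewrite big_cons.
Qed.

Open Scope C_scope.

Theorem theorem3p21 (n : nat) (x : 'I_n -> C)
    (hn : (1 <= n)%N)
    (hx : forall (j : 'I_n) (k : nat), x j <> - RtoC (INR k)) :
  has_alt_continuation (multi_power n x) /\
  (forall j : 'I_n, has_alt_continuation (single_power (x j))) /\
  (forall j : 'I_n, mgamma_prod_converges (x j)) /\
  alt_zeta_prod (multi_power n x) =
    RtoC (sqrt (PI / 2)) ^ n / \big[Cmult/RtoC 1]_(j < n) mgamma (x j) /\
  RtoC (sqrt (PI / 2)) ^ n / \big[Cmult/RtoC 1]_(j < n) mgamma (x j) =
    \big[Cmult/RtoC 1]_(j < n) alt_zeta_prod (single_power (x j)).
Proof.
have hlog (j : 'I_n) := log_like_log_shift (x j).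
have hone (j : 'I_n) : has_alt_continuation (single_power (x j)) /\
  exists z, cvgC (regsum (log_shift (x j))) z /\ alt_zeta_prod (single_power (x j)) = Cexp z.
  have [A hA] := hlog j.
  by apply: alt_zeta_prod_exp_terms Rlt_0_1 hA _; exact: single_power_exp_terms.
pose z (j : 'I_n) := proj1_sig (constructive_indefinite_description _ (proj2 (hone j))).
have hz (j : 'I_n) : cvgC (regsum (log_shift (x j))) (z j) /\ alt_zeta_prod (single_power (x j)) = Cexp (z j).
  exact: proj2_sig (constructive_indefinite_description _ (proj2 (hone j))).
have [A hA] := log_like_sum _ (index_enum 'I_n) _ hlog.
have hsize : (0 < INR (size (index_enum 'I_n)))%R.
  have := mem_index_enum (Ordinal hn); case: (index_enum 'I_n) => // i r _.
  rewrite /= -/(INR (S (size r))) S_INR; have := pos_INR (size r); lra.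
have [hm [w [hw ew]]] := alt_zeta_prod_exp_terms _ _ _ (multi_power n x) hsize hA (multi_power_exp_terms n x).
have ezw : w = \big[Cplus/RtoC 0]_(j < n) z j.
  by apply: cvgC_unique hw (regsum_sum _ _ _ _ (fun j => proj1 (hz j))).
have hgamma (j : 'I_n) := mgamma_of_regsum (x j) (hx j) (z j) (proj1 (hz j)).
have hs0 : RtoC (sqrt (PI / 2)) <> RtoC 0.
  by move/RtoC_inj; have hpi := PI_RGT_0; have := sqrt_lt_R0 (PI / 2) ltac:(lra); lra.
have eexp : \big[Cmult/RtoC 1]_(j < n) alt_zeta_prod (single_power (x j)) = Cexp w.
  rewrite ezw (big_morph Cexp Cexp_plus Cexp_0).
  by apply: eq_bigr => j _; case: (hz j).
have eright : RtoC (sqrt (PI / 2)) ^ n / \big[Cmult/RtoC 1]_(j < n) mgamma (x j) = Cexp w.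
  have -> : \big[Cmult/RtoC 1]_(j < n) mgamma (x j) =
    RtoC (sqrt (PI / 2)) ^ n * Cexp (- w).
    transitivity (\big[Cmult/RtoC 1]_(j < n) (RtoC (sqrt (PI / 2)) * Cexp (- z j))).
      by apply: eq_bigr => j _; case: (hgamma j).
    have -> : Cexp (- w) = \big[Cmult/RtoC 1]_(j < n) Cexp (- z j).
      rewrite ezw (big_morph (fun u => Cexp (- u)) (id1 := RtoC 1) (op1 := Cmult)) //.
      - by move=> u v; rewrite -Cexp_plus; congr Cexp; ring.
      - have -> : - RtoC 0 = RtoC 0 by ring.
        exact: Cexp_0.
    rewrite big_split /=; congr (_ * _).
    rewrite big_const_ord; elim: (n) => //= k ->; ring.
  rewrite Cexp_opp; field; split; [exact: Cexp_neq_0 | exact: Cpow_nz].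
repeat split.
- exact: hm.
- by move=> j; case: (hone j).
- by move=> j; case: (hgamma j).
- by rewrite ew eright.
- by rewrite eright eexp.
Qed.
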